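(* Let $\mathcal{E}$ be a set of extension axioms and $\Gamma\to\Delta$ a sequent of eNDT formulas. If the game $\mathsf{NB}$ over $\mathcal{E}$ has a proof (winning strategy from $\{\Gamma\mapsto1,\Delta\mapsto0\}$) of size $N$, then $\mathsf{eLNDT}$ has a proof of $\Gamma\to\Delta$ of size polynomial in $N$ over some set of extension axioms $\mathcal{E}'\supseteq\mathcal{E}$.
   Context: Syntax. Fix propositional variables $p,q,\dots$ and disjoint extension variables $e_0,e_1,\dots$. eNDT formulas: $A,B ::= 0 \mid 1 \mid ApB \mid A\lor B \mid e_i$ with $p$ a propositional variable ($ApB$ means ''if $p$ then $B$ else $A$''); $p$ is identified with $0p1$. A set of extension axioms is $\mathcal{E}=\{e_i\leftrightarrow E_i\}_{i<n}$ with each $E_i$ an eNDT formula containing only extension variables among $e_0,\dots,e_{i-1}$. Sequents are pairs of finite lists. $\mathsf{LNDT}$ rules: identity $A\to A$; cut; exchange, weakening, contraction on both sides; axiom $0\to$; from $\Gamma\to\Delta$ infer $\Gamma,1\to\Delta$ and $\Gamma\to\Delta,0$; axiom $\to1$; $\lor$-left (from $\Gamma,A\to\Delta$ and $\Gamma,B\to\Delta$ infer $\Gamma,A\lor B\to\Delta$); $\lor$-right (from $\Gamma\to\Delta,A,B$ infer $\Gamma\to\Delta,A\lor B$); $p$-left (from $\Gamma,A\to\Delta,p$ and $\Gamma,p,B\to\Delta$ infer $\Gamma,ApB\to\Delta$); $p$-right (from $\Gamma\to\Delta,A,p$ and $\Gamma,p\to\Delta,B$ infer $\Gamma\to\Delta,ApB$).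 An $\mathsf{eLNDT}$ proof over $\mathcal{E}$: a finite list of sequents, each a hypothesis $e_i\to E_i$ or $E_i\to e_i$ from $\mathcal{E}$ or derived from earlier ones by an $\mathsf{LNDT}$ rule; size = number of symbols. Simulation: $A\succeq_\mathcal{E} B$ is the smallest relation with: $A\succeq A$; $A\succeq C, A\succeq D\Rightarrow A\succeq C\lor D$; $A\succeq E_i\Rightarrow A\succeq e_i$; $A\succeq C, B\succeq D\Rightarrow ApB\succeq CpD$; $A_j\succeq B\Rightarrow A_0\lor A_1\succeq B$ ($j\in\{0,1\}$); $E_i\succeq B\Rightarrow e_i\succeq B$. Game $\mathsf{NB}$ over $\mathcal{E}$: queries $P,Q::=A\mid\neg Q\mid Q\lor R\mid Q\land R$ with $A$ eNDT. Simple contradictions: $\{0\mapsto1\}$, $\{1\mapsto0\}$; $\{A_0\mapsto b_0,A_1\mapsto b_1,p\mapsto i,A_0pA_1\mapsto c\}$ with $c\ne b_i$; sets inconsistent with the truth tables of $\neg,\lor,\land$ ($\{Q\mapsto b,\neg Q\mapsto b\}$, $\{Q_0\lor Q_1\mapsto0,Q_i\mapsto1\}$, $\{Q_0\lor Q_1\mapsto1,Q_0\mapsto0,Q_1\mapsto0\}$, $\{Q_0\land Q_1\mapsto0,Q_0\mapsto1,Q_1\mapsto1\}$, $\{Q_0\land Q_1\mapsto1,Q_i\mapsto0\}$); $\{e_i\mapsto b,E_i\mapsto1-b\}$; $\{A\mapsto0,B\mapsto1\}$ whenever $A\succeq_\mathcal{E}B$. A winning strategy from a state $S$ (set of Boolean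 assignments to queries) is a finite binary tree with internal nodes labelled by queries and outgoing edges labelled $0,1$, such that along every root-to-leaf path $S$ plus the assignments made contains a simple contradiction. A proof of $\Gamma\to\Delta$ is a winning strategy from $\{\Gamma\mapsto1,\Delta\mapsto0\}$; its size is the number of symbols in it.
   Formalization: The size N counts the symbols of the extension axioms 𝓔 and of the initial state {Γ↦1, Δ↦0} along with those of the strategy tree; with the tree alone the claim fails (E_0 = p, E_{i+1} = e_i∨e_i: a one-leaf tree proves e_n→e_0, but every eLNDT proof needs n axioms). *)

(* Defs.v *)
From Stdlib Require Import List Arith.
Import ListNotations.

Inductive fml : Type :=
| F0 : fml
| F1 : fml
| FDec : fml -> nat -> fml -> fml  (* [FDec A p B] is ApB: if p then B else A *)
| FOr : fml -> fml -> fml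
| FExt : nat -> fml.

Definition pvar (p : nat) : fml := FDec F0 p F1.

Fixpoint ext_vars_below (n : nat) (A : fml) : Prop :=
  match A with
  | F0 | F1 => True
  | FDec B _ C => ext_vars_below n B /\ ext_vars_below n C
  | FOr B C => ext_vars_below n B /\ ext_vars_below n C
  | FExt i => i < n
  end.

(* The list [E_0; ...; E_(n-1)] stands for {e_i <-> E_i}_{i<n}. *)
Definition axiom_list : Type := list fml.

Definition in_axioms (E : axiom_list) (i : nat) (A : fml) : Prop :=
  nth_error E i = Some A.

Definition ext_axioms (E : axiom_list) : Prop :=
  forall i A, in_axioms E i A -> ext_vars_below i A.

Definition axioms_incl (E E' : axiom_list) : Prop :=
  forall i A, in_axioms E i A -> in_axioms E' i A.

Definition sequent : Type := (list fml * list fml)%type.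

(* [LNDT_rule premises conclusion] *)
Inductive LNDT_rule : list sequent -> sequent -> Prop :=
| R_id A : LNDT_rule [] ([A], [A])
| R_cut G D A :
    LNDT_rule [(G, D ++ [A]); (G ++ [A], D)] (G, D)
| R_exL G A B G' D :
    LNDT_rule [(G ++ A :: B :: G', D)] (G ++ B :: A :: G', D)
| R_exR G D A B D' :
    LNDT_rule [(G, D ++ A :: B :: D')] (G, D ++ B :: A :: D')
| R_wkL G D A : LNDT_rule [(G, D)] (G ++ [A], D)
| R_wkR G D A : LNDT_rule [(G, D)] (G, D ++ [A])
| R_ctrL G D A : LNDT_rule [(G ++ [A; A], D)] (G ++ [A], D)
| R_ctrR G D A : LNDT_rule [(G, D ++ [A; A])] (G, D ++ [A])
| R_0L : LNDT_rule [] ([F0], [])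
| R_1L G D : LNDT_rule [(G, D)] (G ++ [F1], D)
| R_0R G D : LNDT_rule [(G, D)] (G, D ++ [F0])
| R_1R : LNDT_rule [] ([], [F1])
| R_orL G D A B :
    LNDT_rule [(G ++ [A], D); (G ++ [B], D)] (G ++ [FOr A B], D)
| R_orR G D A B :
    LNDT_rule [(G, D ++ [A; B])] (G, D ++ [FOr A B])
| R_pL G D A p B :
    LNDT_rule [(G ++ [A], D ++ [pvar p]); (G ++ [pvar p; B], D)]
              (G ++ [FDec A p B], D)
| R_pR G D A p B :
    LNDT_rule [(G, D ++ [A; pvar p]); (G ++ [pvar p], D ++ [B])]
              (G, D ++ [FDec A p B]).

Inductive ext_hypothesis (E : axiom_list) : sequent -> Prop :=
| hyp_unfold i A : in_axioms E i A -> ext_hypothesis E ([FExt i], [A])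
| hyp_fold i A : in_axioms E i A -> ext_hypothesis E ([A], [FExt i]).

Inductive eLNDT_derivation (E : axiom_list) : list sequent -> Prop :=
| der_nil : eLNDT_derivation E []
| der_hyp pi s :
    eLNDT_derivation E pi -> ext_hypothesis E s ->
    eLNDT_derivation E (pi ++ [s])
| der_rule pi prems s :
    eLNDT_derivation E pi -> LNDT_rule prems s -> incl prems pi ->
    eLNDT_derivation E (pi ++ [s]).

Definition eLNDT_proof (E : axiom_list) (pi : list sequent) (s : sequent)
  : Prop :=
  eLNDT_derivation E pi /\ exists pi', pi = pi' ++ [s].

Inductive simulates (E : axiom_list) : fml -> fml -> Prop :=
| sim_refl A : simulates E A A
| sim_orR A C D :
    simulates E A C -> simulates E A D -> simulates E A (FOr C D)
| sim_extR A i Ei :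
    in_axioms E i Ei -> simulates E A Ei -> simulates E A (FExt i)
| sim_dec A p B C D :
    simulates E A C -> simulates E B D -> simulates E (FDec A p B) (FDec C p D)
| sim_orL0 A0 A1 B : simulates E A0 B -> simulates E (FOr A0 A1) B
| sim_orL1 A0 A1 B : simulates E A1 B -> simulates E (FOr A0 A1) B
| sim_extL i Ei B :
    in_axioms E i Ei -> simulates E Ei B -> simulates E (FExt i) B.

Inductive query : Type :=
| QF : fml -> query
| QNeg : query -> query
| QOr : query -> query -> query
| QAnd : query -> query -> query.

(* [QF (FOr A B)] and [QOr (QF A) (QF B)] both represent the query written
   A \/ B, so the truth table of disjunction must apply to both. *)
Inductive is_or : query -> query -> query -> Prop :=
| is_or_fml A B : is_or (QF (FOr A B)) (QF A) (QF B)
| is_or_query Q R : is_or (QOr Q R) Q R.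

Definition state : Type := list (query * bool).

Inductive simple_contradiction (E : axiom_list) : state -> Prop :=
| sc_0 : simple_contradiction E [(QF F0, true)]
| sc_1 : simple_contradiction E [(QF F1, false)]
| sc_dec A0 A1 p (b0 b1 i c : bool) :
    c <> (if i then b1 else b0) ->
    simple_contradiction E
      [(QF A0, b0); (QF A1, b1); (QF (pvar p), i); (QF (FDec A0 p A1), c)]
| sc_neg Q (b : bool) : simple_contradiction E [(Q, b); (QNeg Q, b)]
| sc_or0 P Q0 Q1 (i : bool) :
    is_or P Q0 Q1 ->
    simple_contradiction E [(P, false); (if i then Q1 else Q0, true)]
| sc_or1 P Q0 Q1 :
    is_or P Q0 Q1 ->
    simple_contradiction E [(P, true); (Q0, false); (Q1, false)]
| sc_and0 Q0 Q1 :
    simple_contradiction E [(QAnd Q0 Q1, false); (Q0, true); (Q1, true)]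
| sc_and1 Q0 Q1 (i : bool) :
    simple_contradiction E [(QAnd Q0 Q1, true); (if i then Q1 else Q0, false)]
| sc_ext i Ei (b : bool) :
    in_axioms E i Ei ->
    simple_contradiction E [(QF (FExt i), b); (QF Ei, negb b)]
| sc_sim A B :
    simulates E A B -> simple_contradiction E [(QF A, false); (QF B, true)].

(* [SNode Q T0 T1]: query Q, then T0 on answer 0 and T1 on answer 1. *)
Inductive strategy : Type :=
| SLeaf : strategy
| SNode : query -> strategy -> strategy -> strategy.

Fixpoint winning (E : axiom_list) (S : state) (T : strategy) : Prop :=
  match T with
  | SLeaf => exists C, simple_contradiction E C /\ incl C S
  | SNode Q T0 T1 =>
      winning E ((Q, false) :: S) T0 /\ winning E ((Q, true) :: S) T1
  end.

Definition initial_state (G D : list fml) : state :=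
  map (fun A => (QF A, true)) G ++ map (fun A => (QF A, false)) D.

Definition NB_proof (E : axiom_list) (G D : list fml) (T : strategy) : Prop :=
  winning E (initial_state G D) T.

(* Sizes count symbols; a variable is one symbol, and parentheses and commas
   (a constant factor) are not counted. *)
Fixpoint fml_size (A : fml) : nat :=
  match A with
  | F0 | F1 | FExt _ => 1
  | FDec B _ C => fml_size B + 1 + fml_size C
  | FOr B C => fml_size B + 1 + fml_size C
  end.

Fixpoint query_size (Q : query) : nat :=
  match Q with
  | QF A => fml_size A
  | QNeg R => 1 + query_size R
  | QOr R R' | QAnd R R' => query_size R + 1 + query_size R'
  end.

Definition sequent_size (s : sequent) : nat :=
  list_sum (map fml_size (fst s)) + 1 + list_sum (map fml_size (snd s)).

Definition eLNDT_size (pi : list sequent) : nat :=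
  list_sum (map sequent_size pi).

Definition axioms_size (E : axiom_list) : nat :=
  list_sum (map (fun A => 2 + fml_size A) E).

Definition state_size (S : state) : nat :=
  list_sum (map (fun a => query_size (fst a) + 2) S).

(* Each internal node carries its query and the labels 0, 1 of its edges. *)
Fixpoint strategy_size (T : strategy) : nat :=
  match T with
  | SLeaf => 1
  | SNode Q T0 T1 => query_size Q + 2 + strategy_size T0 + strategy_size T1
  end.

(* A winning strategy is presented together with the axioms it is over and the
   state it starts from, and both are counted. With the tree alone, no bound
   could hold: for E_0 = p and E_(i+1) = e_i \/ e_i, the one-leaf tree proves
   e_n -> e_0, whereas an eLNDT proof has to use all of E_1, ..., E_n; and the
   one-leaf tree proves 0, A -> for A of any size. *)
Definition NB_size (E : axiom_list) (G D : list fml) (T : strategy) : nat :=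
  axioms_size E + state_size (initial_state G D) + strategy_size T.

(* Main.v *)
Require Import Defs.
From Stdlib Require Import List Arith Lia Permutation.
Import ListNotations.

(** eNDT formulas have no negation, so negated queries are read in slices. Let
    L be the list of all eNDT formulas occurring in the queries, and let Th_k
    say that at least k members of L are true. If exactly k members of L are
    true, then the negation of a member A says that at least k of the other
    members are true. This gives every query Q and bit b a positive
    translation, built from eNDT formulas with \/ and /\, and the translations
    of (Q, 0) and (Q, 1) are complementary between Th_k and Th_(k+1). Induction
    on the strategy then derives Th_k, S -> Th_(k+1) for every state S of the
    game. At the root this is Th_k, Gamma -> Delta, Th_(k+1), and cutting along
    k = 0, ..., |L| leaves Gamma -> Delta, because Th_0 is valid and
    Th_(|L|+1) is unsatisfiable.

    Positive translations are named by extension variables: A /\ B is the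
    branching program A with its 1-leaves redirected to B. Only polynomially
    many short sequents between these names are ever needed, and each follows
    from others by a cut tree of constant depth, so proving each of them once
    gives a derivation of polynomial size. *)

Lemma fml_eq_dec (A B : fml) : {A = B} + {A <> B}.
Proof. decide equality; apply Nat.eq_dec. Defined.

Lemma sequent_eq_dec (s t : sequent) : {s = t} + {s <> t}.
Proof. decide equality; apply (list_eq_dec fml_eq_dec). Defined.

Definition fmls_size (G : list fml) : nat := list_sum (map fml_size G).

Lemma fmls_size_cons A G : fmls_size (A :: G) = fml_size A + fmls_size G.
Proof. reflexivity. Qed.

Lemma fmls_size_app G G' : fmls_size (G ++ G') = fmls_size G + fmls_size G'.
Proof. unfold fmls_size. now rewrite map_app, list_sum_app. Qed.

Lemma fmls_size_permutation G G' :
  Permutation G G' -> fmls_size G = fmls_size G'.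
Proof. intros h. unfold fmls_size. now rewrite h. Qed.

Lemma fml_size_pos A : 1 <= fml_size A.
Proof. destruct A; simpl; lia. Qed.

Lemma length_le_fmls_size G : length G <= fmls_size G.
Proof.
  induction G as [|A G IH]; [simpl; lia|].
  rewrite fmls_size_cons. pose proof (fml_size_pos A). simpl. lia.
Qed.

Lemma fml_size_le_fmls_size A G : In A G -> fml_size A <= fmls_size G.
Proof.
  induction G as [|B G IH]; simpl; [easy|].
  rewrite fmls_size_cons. intros [->|h]; [lia|]. specialize (IH h). lia.
Qed.

Lemma fmls_size_le_length_mul G z :
  (forall A, In A G -> fml_size A <= z) -> fmls_size G <= length G * z.
Proof.
  induction G as [|A G IH]; intros h; [now simpl|].
  rewrite fmls_size_cons. pose proof (h A (or_introl eq_refl)).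
  specialize (IH (fun B hB => h B (or_intror hB))). simpl. lia.
Qed.

Lemma fmls_size_incl G G' :
  incl G G' -> fmls_size G <= length G * fmls_size G'.
Proof.
  intros h. apply fmls_size_le_length_mul.
  intros A hA. now apply fml_size_le_fmls_size, h.
Qed.

Lemma sequent_size_pair G D :
  sequent_size (G, D) = fmls_size G + 1 + fmls_size D.
Proof. reflexivity. Qed.

(** * Derivations with bounded sequents *)

Section Deduction.
Variables (E : axiom_list) (M : nat) (H : list sequent).

Definition deducible (c : nat) (l : list sequent) : Prop :=
  forall pi, eLNDT_derivation E pi -> incl H pi ->
  exists ext, eLNDT_derivation E (pi ++ ext) /\ incl l (pi ++ ext) /\
    Forall (fun s => sequent_size s <= M) ext /\ length ext <= c.

Lemma deducible_le c c' l : deducible c l -> c <= c' -> deducible c' l.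
Proof.
  intros h hc pi hpi hH.
  destruct (h pi hpi hH) as (ext & hext & hin & hsize & hlen).
  exists ext. repeat split; auto; lia.
Qed.

Lemma deducible_incl l : incl l H -> deducible 0 l.
Proof.
  intros h pi hpi hH. exists []. rewrite app_nil_r.
  repeat split; auto. now apply incl_tran with H.
Qed.

Lemma deducible_app c c' l l' :
  deducible c l -> deducible c' l' -> deducible (c + c') (l ++ l').
Proof.
  intros h h' pi hpi hH.
  destruct (h pi hpi hH) as (ext & hext & hin & hsize & hlen).
  destruct (h' (pi ++ ext) hext) as (ext' & hext' & hin' & hsize' & hlen');
    [now apply incl_appl|].
  exists (ext ++ ext'). rewrite app_assoc. repeat split; auto.
  - apply incl_app; auto. now apply incl_appl.
  - now apply Forall_app.
  - rewrite length_app. lia.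
Qed.

Lemma deducible_forall c l :
  (forall s, In s l -> deducible c [s]) -> deducible (length l * c) l.
Proof.
  induction l as [|s l IH]; intros h; [now apply deducible_incl|].
  apply (deducible_app _ _ [s] l); auto with datatypes.
Qed.

Lemma deducible_rule c prems s :
  deducible c prems -> LNDT_rule prems s -> sequent_size s <= M ->
  deducible (c + 1) [s].
Proof.
  intros h hr hs pi hpi hH.
  destruct (h pi hpi hH) as (ext & hext & hin & hsize & hlen).
  exists (ext ++ [s]). rewrite app_assoc. repeat split.
  - now apply der_rule with prems.
  - apply incl_appr, incl_refl.
  - apply Forall_app; auto.
  - rewrite length_app. simpl. lia.
Qed.

Lemma deducible_hypothesis s :
  ext_hypothesis E s -> sequent_size s <= M -> deducible 1 [s].
Proof.
  intros h hs pi hpi hH. exists [s]. repeat split; auto.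
  - now apply der_hyp.
  - apply incl_appr, incl_refl.
Qed.

(* [mk] is one side of a sequent whose other side, of size [r], is fixed, so
   that the structural rules are treated once for both sides. *)
Section OneSide.
Variables (mk : list fml -> sequent) (r : nat).
Hypothesis mk_exchange : forall G A B G',
  LNDT_rule [mk (G ++ A :: B :: G')] (mk (G ++ B :: A :: G')).
Hypothesis mk_weakening : forall G A, LNDT_rule [mk G] (mk (G ++ [A])).
Hypothesis mk_contraction : forall G A,
  LNDT_rule [mk (G ++ [A; A])] (mk (G ++ [A])).
Hypothesis mk_size : forall G, sequent_size (mk G) = fmls_size G + r.

Lemma deducible_move_left A Q : forall P S c,
  fmls_size (P ++ Q ++ A :: S) + r <= M ->
  deducible c [mk (P ++ Q ++ A :: S)] ->
  deducible (c + length Q) [mk (P ++ A :: Q ++ S)].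
Proof.
  induction Q as [|B Q IH]; intros P S c hs h.
  - now rewrite Nat.add_0_r.
  - simpl in *. rewrite Nat.add_succ_r, <- Nat.add_1_r.
    apply deducible_rule with (2 := mk_exchange P B A (Q ++ S)).
    + replace (P ++ B :: A :: Q ++ S) with ((P ++ [B]) ++ A :: Q ++ S)
        by now rewrite <- app_assoc.
      apply IH; now rewrite <- app_assoc.
    + rewrite mk_size. etransitivity; [|exact hs].
      apply Nat.add_le_mono_r, Nat.eq_le_incl, fmls_size_permutation.
      apply Permutation_app_head, (Permutation_middle (B :: Q)).
Qed.

Lemma deducible_permutation G' : forall G P c,
  Permutation G G' -> fmls_size (P ++ G) + r <= M ->
  deducible c [mk (P ++ G)] ->
  deducible (c + length G' * M) [mk (P ++ G')].
Proof.
  induction G' as [|A G' IH]; intros G P c hp hs h.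
  - apply Permutation_sym, Permutation_nil in hp as ->.
    now rewrite Nat.add_0_r.
  - assert (hA : In A G)
      by (apply Permutation_in with (1 := Permutation_sym hp); simpl; auto).
    apply in_split in hA as (Ga & Gb & ->).
    pose proof (length_le_fmls_size (P ++ Ga ++ A :: Gb)) as hl.
    rewrite !length_app in hl.
    apply deducible_le with ((c + length Ga) + length G' * M);
      [|simpl; lia].
    apply deducible_move_left in h; [|assumption].
    replace (P ++ A :: G') with ((P ++ [A]) ++ G') by now rewrite <- app_assoc.
    apply IH with (Ga ++ Gb).
    + exact (Permutation_app_inv Ga Gb [] G' A hp).
    + etransitivity; [|exact hs].
      apply Nat.add_le_mono_r, Nat.eq_le_incl, fmls_size_permutation.
      rewrite <- app_assoc.
      apply Permutation_app_head. exact (Permutation_middle Ga Gb A).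
    + now rewrite <- app_assoc.
Qed.

Lemma deducible_weaken_right G' : forall G c,
  fmls_size (G ++ G') + r <= M -> deducible c [mk G] ->
  deducible (c + length G') [mk (G ++ G')].
Proof.
  induction G' as [|A G' IH] using rev_ind; intros G c hs h.
  - now rewrite app_nil_r, Nat.add_0_r.
  - rewrite app_assoc in *. rewrite length_app, Nat.add_assoc.
    apply deducible_rule with (2 := mk_weakening (G ++ G') A);
      [|now rewrite mk_size].
    apply IH; auto. rewrite fmls_size_app in hs. lia.
Qed.

Lemma deducible_absorb G' G : forall c,
  incl G G' -> fmls_size (G ++ G') + r <= M -> deducible c [mk (G ++ G')] ->
  deducible (c + length G * (2 * M * M + 1)) [mk G'].
Proof.
  induction G as [|A G IH]; intros c hi hs h.
  - now rewrite Nat.add_0_r.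
  - apply incl_cons_inv in hi as [hA hi].
    apply in_split in hA as (Ga & Gb & e).
    set (R := G ++ Ga ++ Gb).
    assert (after : Permutation (G ++ G') (R ++ [A])).
    { unfold R. rewrite e, <- Permutation_cons_append, <- !Permutation_middle.
      reflexivity. }
    assert (before : Permutation ((A :: G) ++ G') (R ++ [A; A])).
    { simpl. rewrite after, Permutation_cons_append, <- app_assoc.
      reflexivity. }
    pose proof (fmls_size_permutation _ _ after).
    pose proof (length_le_fmls_size (R ++ [A; A])).
    pose proof (length_le_fmls_size (G ++ G')).
    pose proof (fmls_size_permutation _ _ before) as hbefore.
    simpl app in hbefore, hs. rewrite fmls_size_cons in hbefore, hs.
    apply (deducible_permutation _ _ [] _ before) in h;
      [|simpl; rewrite fmls_size_cons; exact hs].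
    apply deducible_rule with (s := mk (R ++ [A])) in h;
      [|apply mk_contraction|rewrite mk_size; lia].
    apply (deducible_permutation _ _ [] _ (Permutation_sym after)) in h;
      [|simpl; lia].
    apply IH in h; [|assumption|lia].
    eapply deducible_le; [exact h|]. simpl. nia.
Qed.

Lemma deducible_one_side_weakening G G' c :
  incl G G' -> fmls_size (G ++ G') + r <= M -> deducible c [mk G] ->
  deducible (c + (M + M * (2 * M * M + 1))) [mk G'].
Proof.
  intros hi hs h. pose proof (length_le_fmls_size (G ++ G')) as hl.
  rewrite length_app in hl.
  apply deducible_weaken_right with (G' := G') in h; [|assumption].
  apply deducible_absorb in h; auto.
  eapply deducible_le; [exact h|]. nia.
Qed.
End OneSide.

Definition weakening_cost : nat := 2 * (M + M * (2 * M * M + 1)).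

Lemma deducible_weakening G D G' D' c :
  incl G G' -> incl D D' ->
  sequent_size (G, D) + sequent_size (G', D') <= M ->
  deducible c [(G, D)] -> deducible (c + weakening_cost) [(G', D')].
Proof.
  intros hG hD hM h. rewrite !sequent_size_pair in hM.
  apply deducible_one_side_weakening
    with (mk := fun G => (G, D)) (r := 1 + fmls_size D) (G' := G') in h;
    try (intros; constructor); auto;
    try (intros; rewrite ?fmls_size_app, ?sequent_size_pair; lia).
  apply deducible_one_side_weakening
    with (mk := fun D => (G', D)) (r := fmls_size G' + 1) (G' := D') in h;
    try (intros; constructor); auto;
    try (intros; rewrite ?fmls_size_app, ?sequent_size_pair; lia).
  eapply deducible_le; [exact h|]. unfold weakening_cost. lia.
Qed.

Lemma deducible_identity G D A :
  In A G -> In A D -> 2 * sequent_size (G, D) <= M ->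
  deducible (1 + weakening_cost) [(G, D)].
Proof.
  intros hG hD hM. rewrite sequent_size_pair in hM.
  pose proof (fml_size_le_fmls_size _ _ hG).
  pose proof (fml_size_le_fmls_size _ _ hD).
  assert (hs : sequent_size ([A], [A]) + sequent_size (G, D) <= M).
  { rewrite !sequent_size_pair. unfold fmls_size in *. simpl. lia. }
  apply deducible_weakening with [A] [A]; auto.
  - now intros x [<-|[]].
  - now intros x [<-|[]].
  - apply (deducible_rule 0 []); [now apply deducible_incl|constructor|lia].
Qed.

Lemma deducible_cut G D A c :
  2 * (sequent_size (G, D) + fml_size A) <= M ->
  deducible c [(G, A :: D)] -> deducible c [(A :: G, D)] ->
  deducible (2 * (c + weakening_cost) + 1) [(G, D)].
Proof.
  intros hM hR hL. rewrite sequent_size_pair in hM.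
  assert (hsnoc : forall X, Permutation (A :: X) (X ++ [A]))
    by (intros; apply Permutation_cons_append).
  assert (hincl : forall X, incl (A :: X) (X ++ [A]))
    by (intros X B; apply Permutation_in, hsnoc).
  assert (hsize : forall X, fmls_size (X ++ [A]) = fml_size A + fmls_size X)
    by (intros X; now rewrite <- (fmls_size_permutation _ _ (hsnoc X))).
  simpl Nat.mul. rewrite Nat.add_0_r.
  apply deducible_rule with (2 := R_cut G D A);
    [|rewrite sequent_size_pair; lia].
  apply (deducible_app _ _ [_] [_]).
  - apply deducible_weakening with G (A :: D); auto using incl_refl.
    rewrite !sequent_size_pair, hsize, fmls_size_cons. lia.
  - apply deducible_weakening with (A :: G) D; auto using incl_refl.
    rewrite !sequent_size_pair, hsize, fmls_size_cons. lia.
Qed.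

Inductive initial_sequent : sequent -> Prop :=
| init_id A : initial_sequent ([A], [A])
| init_0 : initial_sequent ([F0], [])
| init_1 : initial_sequent ([], [F1])
| init_or_right0 A B : initial_sequent ([A], [FOr A B])
| init_or_right1 A B : initial_sequent ([B], [FOr A B])
| init_or_left A B : initial_sequent ([FOr A B], [A; B])
| init_dec_right0 A p B : initial_sequent ([A], [pvar p; FDec A p B])
| init_dec_right1 A p B : initial_sequent ([pvar p; B], [FDec A p B])
| init_dec_left0 A p B : initial_sequent ([FDec A p B], [A; pvar p])
| init_dec_left1 A p B : initial_sequent ([pvar p; FDec A p B], [B])
| init_unfold i A : in_axioms E i A -> initial_sequent ([FExt i], [A])
| init_fold i A : in_axioms E i A -> initial_sequent ([A], [FExt i]).

Lemma initial_sequent_length G D :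
  initial_sequent (G, D) -> length G <= 2 /\ length D <= 2.
Proof. inversion 1; simpl; lia. Qed.

Definition valid_by_identity (s s' : sequent) : Prop :=
  (exists A, In A (fst s) /\ In A (snd s)) /\
  sequent_size s <= 3 * sequent_size s'.

Lemma deducible_from_identities prems s :
  LNDT_rule prems s -> (forall p, In p prems -> valid_by_identity p s) ->
  length prems <= 2 -> 6 * sequent_size s <= M ->
  deducible (3 + 2 * weakening_cost) [s].
Proof.
  intros hr hprems hl hM.
  apply deducible_le with (length prems * (1 + weakening_cost) + 1); [|nia].
  apply deducible_rule with (2 := hr); [|lia].
  apply deducible_forall. intros [G D] hp.
  destruct (hprems _ hp) as [(A & hG & hD) hs].
  apply deducible_identity with A; auto. lia.
Qed.

Ltac identity_premise A :=
  split; [exists A; simpl; tauto|unfold sequent_size; simpl; lia].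

Lemma deducible_initial s :
  initial_sequent s -> 6 * sequent_size s <= M ->
  deducible (3 + 2 * weakening_cost) [s].
Proof.
  intros h hM. destruct h.
  - apply deducible_from_identities with []; auto; [constructor|easy].
  - apply deducible_from_identities with []; auto; [constructor|easy].
  - apply deducible_from_identities with []; auto; [constructor|easy].
  - eapply deducible_from_identities; [apply (R_orR [A] [])|..]; auto.
    intros p' [<-|[]]. identity_premise A.
  - eapply deducible_from_identities; [apply (R_orR [B] [])|..]; auto.
    intros p' [<-|[]]. identity_premise B.
  - eapply deducible_from_identities; [apply (R_orL [] [A; B])|..]; auto.
    intros p' [<-|[<-|[]]]; [identity_premise A|identity_premise B].
  - eapply deducible_from_identities; [apply (R_pR [A] [pvar p])|..]; auto.
    intros p' [<-|[<-|[]]]; [identity_premise A|identity_premise (pvar p)].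
  - eapply deducible_from_identities; [apply (R_pR [pvar p; B] [])|..]; auto.
    intros p' [<-|[<-|[]]]; [identity_premise (pvar p)|identity_premise B].
  - eapply deducible_from_identities; [apply (R_pL [] [A; pvar p])|..]; auto.
    intros p' [<-|[<-|[]]]; [identity_premise A|identity_premise (pvar p)].
  - eapply deducible_from_identities; [apply (R_pL [pvar p] [B])|..]; auto.
    intros p' [<-|[<-|[]]]; [identity_premise (pvar p)|identity_premise B].
  - apply deducible_le with 1; [|lia].
    apply deducible_hypothesis; [now constructor|lia].
  - apply deducible_le with 1; [|lia].
    apply deducible_hypothesis; [now constructor|lia].
Qed.
End Deduction.

(** * Cut trees *)

Section CutTrees.
Variables (E : axiom_list) (z : nat).

Definition available (lemmas : sequent -> Prop) (s : sequent) : Prop :=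
  initial_sequent E s \/ lemmas s.

Inductive cut_tree (lemmas : sequent -> Prop)
  : nat -> list fml -> list fml -> Prop :=
| cut_leaf n G0 D0 G D :
    available lemmas (G0, D0) -> incl G0 G -> incl D0 D ->
    cut_tree lemmas n G D
| cut_node n A G D :
    fml_size A <= z ->
    cut_tree lemmas n (A :: G) D -> cut_tree lemmas n G (A :: D) ->
    cut_tree lemmas (S n) G D.

Lemma cut_tree_mono (lemmas lemmas' : sequent -> Prop) n G D :
  (forall s, lemmas s -> lemmas' s) ->
  cut_tree lemmas n G D -> cut_tree lemmas' n G D.
Proof.
  intros hi h.
  induction h as [n G0 D0 G D [h|h] hG hD|n A G D hA hl IHl hr IHr].
  - apply cut_leaf with G0 D0; auto. now left.
  - apply cut_leaf with G0 D0; auto. right. auto.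
  - now apply cut_node with A.
Qed.

Lemma cut_tree_le lemmas n n' G D :
  cut_tree lemmas n G D -> n <= n' -> cut_tree lemmas n' G D.
Proof.
  intros h. revert n'.
  induction h as [n G0 D0 G D h hG hD|n A G D hA hl IHl hr IHr]; intros n' hn.
  - now apply cut_leaf with G0 D0.
  - destruct n' as [|n']; [lia|]. apply cut_node with A; auto with arith.
Qed.

Lemma cut_tree_weakening lemmas n G D G' D' :
  cut_tree lemmas n G D -> incl G G' -> incl D D' ->
  cut_tree lemmas n G' D'.
Proof.
  intros h. revert G' D'.
  induction h as [n G0 D0 G D h hG hD|n A G D hA hl IHl hr IHr];
    intros G' D' hG' hD'.
  - apply cut_leaf with G0 D0; eauto using incl_tran.
  - apply cut_node with A; auto.
    + apply IHl; auto. now apply (incl_app_app (incl_refl [A])).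
    + apply IHr; auto. now apply (incl_app_app (incl_refl [A])).
Qed.

Fixpoint cut_tree_cost (n w : nat) : nat :=
  match n with
  | 0 => 3 + 3 * w
  | S n => 2 * (cut_tree_cost n w + w) + 1
  end.

Lemma cut_tree_cost_ge n w : 3 + 3 * w <= cut_tree_cost n w.
Proof. induction n; simpl; lia. Qed.

Lemma deducible_cut_tree M lemmas n G D b :
  (forall s, In s lemmas -> sequent_size s <= b) -> 12 * b <= M ->
  cut_tree (fun s => In s lemmas) n G D -> sequent_size (G, D) + n * z <= b ->
  deducible E M lemmas (cut_tree_cost n (weakening_cost M)) [(G, D)].
Proof.
  intros hlemmas hM h.
  induction h as [n G0 D0 G D [h|h] hG hD|n A G D hA hl IHl hr IHr]; intros hb.
  - pose proof (initial_sequent_length _ _ _ h) as [hlG hlD].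
    pose proof (fmls_size_incl _ _ hG). pose proof (fmls_size_incl _ _ hD).
    pose proof (cut_tree_cost_ge n (weakening_cost M)).
    rewrite sequent_size_pair in hb.
    assert (hs : sequent_size (G0, D0) <= 2 * b)
      by (rewrite sequent_size_pair; nia).
    apply deducible_le with (3 + 2 * weakening_cost M + weakening_cost M);
      [|lia].
    apply deducible_weakening with (1 := hG) (2 := hD);
      [rewrite (sequent_size_pair G D); lia|].
    apply deducible_initial; [exact h|lia].
  - specialize (hlemmas _ h).
    pose proof (cut_tree_cost_ge n (weakening_cost M)).
    apply deducible_le with (0 + weakening_cost M); [|lia].
    apply deducible_weakening with (1 := hG) (2 := hD); [lia|].
    apply deducible_incl. now intros s [<-|[]].
  - rewrite sequent_size_pair in hb. simpl in hb.
    apply deducible_cut with A;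
      [rewrite sequent_size_pair; lia|apply IHr|apply IHl];
      rewrite sequent_size_pair, fmls_size_cons; lia.
Qed.
End CutTrees.

(** * Sequents provable by cut trees *)

Section CutProofs.
Variables (E : axiom_list) (z n : nat) (U : list sequent).

(* The least subset of [U] that is closed under cut trees of depth [n]. *)
Definition cut_provable (s : sequent) : Prop :=
  forall P : sequent -> Prop,
    (forall G D, In (G, D) U -> cut_tree E z P n G D -> P (G, D)) -> P s.

Inductive cut_sequence : list sequent -> Prop :=
| cut_sequence_nil : cut_sequence []
| cut_sequence_cons G D V :
    cut_sequence V -> In (G, D) U -> ~ In (G, D) V ->
    cut_tree E z (fun s => In s V) n G D -> cut_sequence ((G, D) :: V).

Lemma cut_sequence_incl V : cut_sequence V -> incl V U.
Proof. intros h. induction h; [easy|]. now apply incl_cons. Qed.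

Lemma cut_sequence_length V : cut_sequence V -> length V <= length U.
Proof.
  intros h. apply NoDup_incl_length.
  - induction h; now constructor.
  - now apply cut_sequence_incl.
Qed.

Definition attainable (s : sequent) : Prop :=
  forall V, cut_sequence V ->
  exists V', cut_sequence V' /\ incl V V' /\ In s V'.

Lemma cut_tree_attained m G D :
  cut_tree E z attainable m G D -> forall V, cut_sequence V ->
  exists V', cut_sequence V' /\ incl V V' /\
    cut_tree E z (fun s => In s V') m G D.
Proof.
  intros h. induction h as [m G0 D0 G D [h|h] hG hD|m A G D hA hl IHl hr IHr];
    intros V hV.
  - exists V. repeat split; auto using incl_refl.
    apply cut_leaf with G0 D0; auto. now left.
  - destruct (h V hV) as (V' & hV' & hi & hin).
    exists V'. repeat split; auto. apply cut_leaf with G0 D0; auto. now right.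
  - destruct (IHl V hV) as (Vl & hVl & hil & htl).
    destruct (IHr Vl hVl) as (Vr & hVr & hir & htr).
    exists Vr. repeat split; eauto using incl_tran.
    apply cut_node with A; auto. now apply cut_tree_mono with (2 := htl).
Qed.

Lemma cut_sequence_of_provable s :
  cut_provable s -> exists V, cut_sequence V /\ In s V.
Proof.
  intros hs.
  assert (h : attainable s).
  { apply hs. intros G D hU ht V hV.
    destruct (cut_tree_attained n G D ht V hV) as (V' & hV' & hi & ht').
    destruct (in_dec sequent_eq_dec (G, D) V') as [hin|hin]; [eauto|].
    exists ((G, D) :: V'). repeat split; [now constructor| |apply in_eq].
    now apply incl_tl. }
  destruct (h [] cut_sequence_nil) as (V & hV & _ & hin). eauto.
Qed.

Lemma derivation_of_cut_sequence b M V :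
  (forall s, In s U -> sequent_size s <= b) -> 12 * (b + n * z) <= M ->
  cut_sequence V ->
  exists pi, eLNDT_derivation E pi /\ incl V pi /\
    Forall (fun s => sequent_size s <= M) pi /\
    length pi <= length V * cut_tree_cost n (weakening_cost M).
Proof.
  intros hb hM h. pose proof (cut_sequence_incl V h) as hV.
  induction h as [|G D V h IH hU _ ht].
  - exists []. repeat split; simpl; auto using incl_refl, der_nil.
  - apply incl_cons_inv in hV as [_ hV].
    destruct (IH hV) as (pi & hpi & hin & hsize & hlen).
    assert (hd : deducible E M V (cut_tree_cost n (weakening_cost M)) [(G, D)]).
    { apply deducible_cut_tree with (z := z) (b := b + n * z); auto.
      - intros s hs. apply Nat.le_trans with b; [auto|lia].
      - apply Nat.add_le_mono_r. auto. }
    destruct (hd pi hpi hin) as (ext & hext & hin' & hsize' & hlen').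
    exists (pi ++ ext). repeat split; auto.
    + apply incl_cons; [apply hin', in_eq|now apply incl_appl].
    + now apply Forall_app.
    + rewrite length_app. simpl. lia.
Qed.
End CutProofs.

Lemma derivation_prefix E pi ext :
  eLNDT_derivation E (pi ++ ext) -> eLNDT_derivation E pi.
Proof.
  induction ext as [|x ext IH] using rev_ind; [now rewrite app_nil_r|].
  rewrite app_assoc. intros h. apply IH.
  inversion h as [e|pi' s hpi' hs e|pi' prems s hpi' hr hprems e].
  - now destruct (pi ++ ext).
  - now apply app_inj_tail in e as [-> _].
  - now apply app_inj_tail in e as [-> _].
Qed.

Lemma eLNDT_size_le M pi :
  Forall (fun s => sequent_size s <= M) pi -> eLNDT_size pi <= length pi * M.
Proof.
  unfold eLNDT_size. induction 1 as [|s pi hs h IH]; simpl; lia.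
Qed.

Lemma proof_of_derivation E M pi s :
  eLNDT_derivation E pi -> In s pi ->
  Forall (fun s => sequent_size s <= M) pi ->
  exists pi', eLNDT_proof E pi' s /\ eLNDT_size pi' <= length pi * M.
Proof.
  intros h hs hM. apply in_split in hs as (pi1 & pi2 & ->).
  rewrite (app_assoc pi1 [s] pi2 : pi1 ++ s :: pi2 = _) in *.
  apply Forall_app in hM as [hM _].
  exists (pi1 ++ [s]). split.
  - split; [|eauto]. now apply derivation_prefix with pi2.
  - rewrite length_app. pose proof (eLNDT_size_le _ _ hM). nia.
Qed.

Lemma proof_of_cut_provable E z n b M U s :
  (forall s, In s U -> sequent_size s <= b) -> 12 * (b + n * z) <= M ->
  cut_provable E z n U s ->
  exists pi, eLNDT_proof E pi s /\
    eLNDT_size pi <= length U * cut_tree_cost n (weakening_cost M) * M.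
Proof.
  intros hb hM hs.
  destruct (cut_sequence_of_provable E z n U s hs) as (V & hV & hin).
  destruct (derivation_of_cut_sequence E z n U b M V)
    as (pi & hpi & hVpi & hlines & hlen); auto.
  destruct (proof_of_derivation E M pi s) as (pi' & hproof & hsize); auto.
  exists pi'. split; [exact hproof|]. etransitivity; [exact hsize|].
  apply Nat.mul_le_mono_r. etransitivity; [exact hlen|].
  apply Nat.mul_le_mono_r, cut_sequence_length with (1 := hV).
Qed.

(** * Conjunctive formulas and their names *)

Inductive cfml : Type :=
| CF : fml -> cfml
| COr : cfml -> cfml -> cfml
| CAnd : cfml -> cfml -> cfml.

Lemma cfml_eq_dec (X Y : cfml) : {X = Y} + {X <> Y}.
Proof. decide equality; apply fml_eq_dec. Defined.

Inductive shape : Type :=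
| Sh0 : shape
| Sh1 : shape
| ShVar : cfml -> shape
| ShOr : cfml -> cfml -> shape
| ShDec : cfml -> nat -> cfml -> shape.

Definition shape_vars (h : shape) : list cfml :=
  match h with
  | Sh0 | Sh1 => []
  | ShVar X => [X]
  | ShOr X Y | ShDec X _ Y => [X; Y]
  end.

Definition shape_fml (name : cfml -> nat) (h : shape) : fml :=
  match h with
  | Sh0 => F0
  | Sh1 => F1
  | ShVar X => FExt (name X)
  | ShOr X Y => FOr (FExt (name X)) (FExt (name Y))
  | ShDec X p Y => FDec (FExt (name X)) p (FExt (name Y))
  end.

(* A branching program is conjoined with [Y] by redirecting its 1-leaves to
   [Y], which needs no negation. *)
Definition shape_and (h : shape) (Y : cfml) : shape :=
  match h with
  | Sh0 => Sh0
  | Sh1 => ShVar Y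
  | ShVar X => ShVar (CAnd X Y)
  | ShOr X X' => ShOr (CAnd X Y) (CAnd X' Y)
  | ShDec X p X' => ShDec (CAnd X Y) p (CAnd X' Y)
  end.

Section Expansion.
Variable E : axiom_list.

Fixpoint expansion (X : cfml) : shape :=
  match X with
  | CF F0 => Sh0
  | CF F1 => Sh1
  | CF (FDec A p B) => ShDec (CF A) p (CF B)
  | CF (FOr A B) => ShOr (CF A) (CF B)
  (* A variable without an axiom is treated as 0. *)
  | CF (FExt i) => ShVar (CF (nth i E F0))
  | COr X Y => ShOr X Y
  | CAnd X Y => shape_and (expansion X) Y
  end.

Definition children (X : cfml) : list cfml := shape_vars (expansion X).

(* Read from right to left, such a list is a legitimate order in which to
   introduce extension variables. *)
Inductive grounded : list cfml -> Prop :=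
| grounded_nil : grounded []
| grounded_cons X l : incl (children X) l -> grounded l -> grounded (X :: l).

Lemma grounded_closed l X : grounded l -> In X l -> incl (children X) l.
Proof.
  induction 1 as [|Y l hY h IH]; [easy|].
  intros [<-|hX]; apply incl_tl; auto.
Qed.

Lemma grounded_induction (P : cfml -> Prop) l :
  grounded l ->
  (forall X, In X l -> (forall Y, In Y (children X) -> P Y) -> P X) ->
  forall X, In X l -> P X.
Proof.
  induction 1 as [|Y l hY h IH]; [easy|]. intros hP.
  assert (hl : forall X, In X l -> P X)
    by (apply IH; intros; apply hP; simpl; auto).
  intros X [<-|hX]; auto. apply hP; simpl; auto.
Qed.

Lemma grounded_prepend l l' :
  (forall X, In X l -> incl (children X) l') -> grounded l' ->
  grounded (l ++ l').
Proof.
  intros h h'. induction l as [|X l IH]; [exact h'|].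
  simpl. constructor.
  - apply incl_appr, h. simpl; auto.
  - apply IH. intros Y hY. apply h. simpl; auto.
Qed.

Lemma grounded_app l l' : grounded l -> grounded l' -> grounded (l ++ l').
Proof.
  intros h h'. induction h as [|X l hX h IH]; [exact h'|].
  simpl. constructor; [now apply incl_appl|exact IH].
Qed.

Lemma grounded_flat_map {A} (f : A -> list cfml) l :
  (forall a, In a l -> grounded (f a)) -> grounded (flat_map f l).
Proof.
  induction l as [|a l IH]; intros h; simpl; [constructor|].
  apply grounded_app; auto with datatypes.
Qed.

Lemma children_and X Y :
  incl (children (CAnd X Y)) (map (fun Z => CAnd Z Y) (children X) ++ [Y]).
Proof.
  unfold children. simpl.
  destruct (expansion X); intros Z hZ; simpl in *; tauto.
Qed.

Lemma grounded_and Y l l' :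
  grounded l -> grounded l' -> In Y l' ->
  grounded (map (fun X => CAnd X Y) l ++ l').
Proof.
  intros h h' hY. induction h as [|X l hX h IH]; [exact h'|].
  simpl. constructor; [|exact IH].
  apply incl_tran with (1 := children_and X Y).
  apply incl_app_app; [now apply incl_map|now intros Z [<-|[]]].
Qed.

Lemma grounded_ands {A} (f : A -> cfml) (ks : list A) l l' :
  grounded l -> grounded l' -> (forall k, In k ks -> In (f k) l') ->
  grounded (flat_map (fun k => map (fun X => CAnd X (f k)) l) ks ++ l').
Proof.
  intros hl hl' hf. induction ks as [|k ks IH]; [exact hl'|].
  simpl. rewrite <- app_assoc. apply grounded_and; auto with datatypes.
Qed.

(* The position of the last occurrence of [X], counted from the right end. *)
Fixpoint level (X : cfml) (l : list cfml) : nat :=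
  match l with
  | [] => 0
  | _ :: l => if in_dec cfml_eq_dec X l then level X l else length l
  end.

Lemma level_lt X l : In X l -> level X l < length l.
Proof.
  induction l as [|Y l IH]; simpl; [easy|]. intros _.
  destruct (in_dec cfml_eq_dec X l) as [h|h]; [specialize (IH h)|]; lia.
Qed.

Lemma nth_error_rev_level X l :
  In X l -> nth_error (rev l) (level X l) = Some X.
Proof.
  induction l as [|Y l IH]; simpl; [easy|]. intros hX.
  destruct (in_dec cfml_eq_dec X l) as [h|h].
  - rewrite nth_error_app1; auto. rewrite length_rev. now apply level_lt.
  - rewrite nth_error_app2; rewrite length_rev, ?Nat.sub_diag; [|lia].
    destruct hX as [->|hX]; easy.
Qed.

Lemma level_le X l j : nth_error (rev l) j = Some X -> level X l <= j.
Proof.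
  induction l as [|Y l IH]; simpl; [lia|]. intros h.
  destruct (Nat.lt_ge_cases j (length l)) as [hj|hj].
  - rewrite nth_error_app1 in h by now rewrite length_rev.
    destruct (in_dec cfml_eq_dec X l) as [hX|hX]; auto.
    destruct hX. apply in_rev. now apply nth_error_In in h.
  - destruct (in_dec cfml_eq_dec X l) as [hX|hX]; [|exact hj].
    pose proof (level_lt _ _ hX). lia.
Qed.

Lemma level_children l X Y :
  grounded l -> In X l -> In Y (children X) -> level Y l < level X l.
Proof.
  intros h. induction h as [|Z l hZ h IH]; simpl; [easy|]. intros hX hY.
  destruct (in_dec cfml_eq_dec X l) as [hX'|hX'].
  - destruct (in_dec cfml_eq_dec Y l) as [hY'|hY']; [now apply IH|].
    destruct hY'. now apply (grounded_closed l X).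
  - destruct hX as [<-|hX]; [|easy].
    destruct (in_dec cfml_eq_dec Y l) as [hY'|hY']; [now apply level_lt|].
    destruct hY'. now apply hZ.
Qed.

Lemma shape_fml_below name h n :
  (forall X, In X (shape_vars h) -> name X < n) ->
  ext_vars_below n (shape_fml name h).
Proof. destruct h; simpl; auto. Qed.

Definition is_name (E' : axiom_list) (name : cfml -> nat) (X : cfml) : Prop :=
  in_axioms E' (name X) (shape_fml name (expansion X)).

Lemma grounded_names l m :
  ext_axioms E -> grounded l ->
  exists E' name, ext_axioms E' /\ axioms_incl E E' /\
    (forall X, In X l -> is_name E' name X) /\
    (forall i, i < m -> in_axioms E' i (nth i E F0)).
Proof.
  intros hE hl.
  set (E0 := E ++ repeat F0 m).
  set (name := fun X => length E0 + level X l).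
  set (body := fun X => shape_fml name (expansion X)).
  exists (E0 ++ map body (rev l)), name. unfold is_name, in_axioms.
  assert (hinE : forall i A,
    nth_error E i = Some A -> nth_error (E0 ++ map body (rev l)) i = Some A).
  { intros i A h. unfold E0. rewrite <- app_assoc, nth_error_app1; auto.
    apply nth_error_Some. congruence. }
  repeat split.
  - intros i A h. unfold in_axioms in h.
    destruct (Nat.lt_ge_cases i (length E0)) as [hi|hi].
    + rewrite nth_error_app1 in h by auto. unfold E0 in h.
      destruct (Nat.lt_ge_cases i (length E)) as [hi'|hi'].
      * rewrite nth_error_app1 in h by auto. now apply hE.
      * rewrite nth_error_app2 in h by auto.
        apply nth_error_In, repeat_spec in h as ->. exact I.
    + rewrite nth_error_app2, nth_error_map in h by auto.
      destruct (nth_error (rev l) (i - length E0)) as [X|] eqn:e; [|easy].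
      injection h as <-. apply shape_fml_below. intros Y hY.
      pose proof (level_le _ _ _ e).
      apply nth_error_In, in_rev in e.
      pose proof (level_children l X Y hl e hY). unfold name. lia.
  - exact hinE.
  - intros X hX. unfold name at 1.
    rewrite nth_error_app2, Nat.add_comm, Nat.add_sub, nth_error_map by lia.
    now rewrite nth_error_rev_level.
  - intros i hi. destruct (Nat.lt_ge_cases i (length E)) as [hi'|hi'].
    + now apply hinE, nth_error_nth'.
    + unfold E0. rewrite <- app_assoc, nth_error_app2, nth_overflow by auto.
      rewrite nth_error_app1 by (rewrite repeat_length; lia).
      apply nth_error_repeat. lia.
Qed.
End Expansion.

(** * Thresholds and values of queries *)

Fixpoint subfmls (A : fml) : list fml :=
  A :: match A with
       | F0 | F1 | FExt _ => []
       | FDec B _ C | FOr B C => subfmls B ++ subfmls C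
       end.

Lemma subfmls_refl A : In A (subfmls A).
Proof. destruct A; simpl; auto. Qed.

Lemma subfmls_vars_below n A i :
  ext_vars_below n A -> In (FExt i) (subfmls A) -> i < n.
Proof.
  induction A as [| |B IHB p C IHC|B IHB C IHC|j]; simpl; intros hA hi;
    try (destruct hi as [hi|hi]; [easy|]; apply in_app_or in hi); try tauto.
  - now destruct hi.
  - now destruct hi.
  - now destruct hi as [[= ->]|].
Qed.

Lemma grounded_subfmls E A : forall l,
  grounded E l ->
  (forall i, In (FExt i) (subfmls A) -> In (CF (nth i E F0)) l) ->
  grounded E (map CF (subfmls A) ++ l).
Proof.
  assert (hrefl : forall B l, In (CF B) (map CF (subfmls B) ++ l))
    by (intros; apply in_or_app; left; apply in_map, subfmls_refl).
  induction A as [| |B IHB p C IHC|B IHB C IHC|j]; intros l hl hA; simpl;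
    try rewrite map_app, <- app_assoc; constructor; auto; try easy.
  - apply incl_cons; [apply hrefl|]. apply incl_cons; [|easy].
    apply in_or_app; right; apply hrefl.
  - apply IHB; [apply IHC; auto|]; intros i hi; [|apply in_or_app; right];
      apply hA; simpl; rewrite in_app_iff; auto.
  - apply incl_cons; [apply hrefl|]. apply incl_cons; [|easy].
    apply in_or_app; right; apply hrefl.
  - apply IHB; [apply IHC; auto|]; intros i hi; [|apply in_or_app; right];
      apply hA; simpl; rewrite in_app_iff; auto.
  - apply incl_cons; [|easy]. apply hA. simpl; auto.
Qed.

Definition base_fmls (E : axiom_list) (L : list fml) : list fml :=
  flat_map subfmls (L ++ rev E ++ [F0]).

Lemma base_fmls_in E L A : In A (L ++ rev E ++ [F0]) -> In A (base_fmls E L).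
Proof.
  intros h. apply in_flat_map. exists A. split; [exact h|apply subfmls_refl].
Qed.

Lemma grounded_axioms E E1 E2 :
  ext_axioms E -> E = E1 ++ E2 ->
  grounded E (map CF (flat_map subfmls (rev E1 ++ [F0]))).
Proof.
  intros hE. revert E2.
  induction E1 as [|A E1 IH] using rev_ind; intros E2 e.
  - repeat constructor; easy.
  - rewrite <- app_assoc in e.
    rewrite rev_unit. simpl. rewrite map_app.
    apply grounded_subfmls; [now apply IH with ([A] ++ E2)|].
    intros i hi. apply subfmls_vars_below with (n := length E1) in hi.
    + rewrite e, app_nth1 by exact hi. apply in_map, in_flat_map.
      exists (nth i E1 F0). split; [|apply subfmls_refl].
      apply in_or_app; left. apply -> in_rev. now apply nth_In.
    + apply hE. unfold in_axioms. rewrite e, nth_error_app2, Nat.sub_diag; auto.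
Qed.

Lemma grounded_base_fmls E L :
  ext_axioms E -> grounded E (map CF (base_fmls E L)).
Proof.
  intros hE. induction L as [|A L IH].
  - apply grounded_axioms with []; [exact hE|]. now rewrite app_nil_r.
  - unfold base_fmls in *. simpl. rewrite map_app.
    apply grounded_subfmls; [exact IH|].
    intros i _. apply in_map, base_fmls_in.
    rewrite !in_app_iff, <- in_rev. simpl.
    destruct (nth_in_or_default i E F0) as [h|h]; auto.
Qed.

Fixpoint threshold (l : list fml) (k : nat) : cfml :=
  match k, l with
  | 0, _ => CF F1
  | S _, [] => CF F0
  | S k', A :: l => COr (threshold l k) (CAnd (CF A) (threshold l k'))
  end.

Fixpoint remove_first (A : fml) (l : list fml) : list fml :=
  match l with
  | [] => []
  | B :: l => if fml_eq_dec A B then l else B :: remove_first A l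
  end.

Lemma remove_first_split A l :
  In A l -> exists l1 l2, l = l1 ++ A :: l2 /\ remove_first A l = l1 ++ l2.
Proof.
  induction l as [|B l IH]; simpl; [easy|].
  destruct (fml_eq_dec A B) as [<-|hne]; [now exists [], l|].
  intros [<-|hA]; [easy|]. destruct (IH hA) as (l1 & l2 & e1 & e2).
  exists (B :: l1), l2. simpl. now rewrite <- e1, <- e2.
Qed.

Lemma remove_first_incl A l : incl (remove_first A l) l.
Proof.
  induction l as [|B l IH]; simpl; [easy|].
  destruct (fml_eq_dec A B); [apply incl_tl, incl_refl|].
  now apply (incl_app_app (incl_refl [B])).
Qed.

Fixpoint query_atoms (Q : query) : list fml :=
  match Q with
  | QF A => [A]
  | QNeg Q => query_atoms Q
  | QOr Q R | QAnd Q R => query_atoms Q ++ query_atoms R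
  end.

Definition components (Q : query) : list query :=
  match Q with
  | QF _ => []
  | QNeg Q => [Q]
  | QOr Q R | QAnd Q R => [Q; R]
  end.

(* The negation of an atom [A] is read in slice [k]: at least [k] members of
   [L] other than [A] are true. *)
Fixpoint value (L : list fml) (k : nat) (Q : query) (b : bool) : cfml :=
  match Q with
  | QF A => if b then CF A else threshold (remove_first A L) k
  | QNeg Q => value L k Q (negb b)
  | QOr Q R => (if b then COr else CAnd) (value L k Q b) (value L k R b)
  | QAnd Q R => (if b then CAnd else COr) (value L k Q b) (value L k R b)
  end.

Definition or_names (X Y : cfml) (l l' : list cfml) : list cfml :=
  COr X Y :: l ++ l'.

(* Only the left conjunct is expanded further, so the number of names grows
   additively along a query. *)
Definition and_names (Y : cfml) (l l' : list cfml) : list cfml :=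
  map (fun X => CAnd X Y) l ++ l'.

Lemma grounded_or_names E X Y l l' :
  grounded E l -> grounded E l' -> In X l -> In Y l' ->
  grounded E (or_names X Y l l').
Proof.
  intros hl hl' hX hY. constructor; [|now apply grounded_app].
  apply incl_cons; [|apply incl_cons; [|easy]]; apply in_or_app; auto.
Qed.

Lemma and_names_in X Y l l' : In X l -> In (CAnd X Y) (and_names Y l l').
Proof.
  intros hX. apply in_or_app; left. now apply (in_map (fun X => CAnd X Y)).
Qed.

Section Names.
Variables (E : axiom_list) (base L : list fml).
Hypothesis base_grounded : grounded E (map CF base).
Hypothesis L_base : incl L base.

Definition slices : nat := length L + 2.

Definition threshold_conjunctions (l : list fml) : list cfml :=
  flat_map (fun k => map (fun X => CAnd X (threshold l k)) (map CF base))
    (seq 0 slices).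

Fixpoint threshold_names (l : list fml) : list cfml :=
  map (threshold l) (seq 0 slices) ++
  match l with
  | [] => []
  | _ :: l => threshold_conjunctions l ++ threshold_names l
  end.

Definition literal_names : list cfml :=
  flat_map (fun A => threshold_names (remove_first A L)) L ++
  threshold_names L ++ map CF base.

Fixpoint value_names (k : nat) (Q : query) (b : bool) : list cfml :=
  match Q with
  | QF _ => literal_names
  | QNeg Q => value_names k Q (negb b)
  | QOr Q R =>
      if b
      then or_names (value L k Q b) (value L k R b)
             (value_names k Q b) (value_names k R b)
      else and_names (value L k R b) (value_names k Q b) (value_names k R b)
  | QAnd Q R =>
      if b
      then and_names (value L k R b) (value_names k Q b) (value_names k R b)
      else or_names (value L k Q b) (value L k R b)
             (value_names k Q b) (value_names k R b)
  end.

Definition query_names (queries : list query) : list cfml :=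
  flat_map (fun k => flat_map
    (fun Q => value_names k Q true ++ value_names k Q false) queries)
    (seq 0 slices) ++
  literal_names.

Lemma threshold_names_in l k :
  k < slices -> In (threshold l k) (threshold_names l).
Proof.
  intros hk. destruct l as [|A l]; apply in_or_app; left;
    (apply (in_map (threshold _)), in_seq; lia).
Qed.

Lemma threshold_conjunctions_in A l k :
  In A base -> k < slices ->
  In (CAnd (CF A) (threshold l k)) (threshold_conjunctions l).
Proof.
  intros hA hk. apply in_flat_map. exists k. split; [apply in_seq; lia|].
  now apply (in_map (fun X => CAnd X (threshold l k))), in_map.
Qed.

Lemma threshold_names_conjunctions A l :
  incl (threshold_conjunctions l) (threshold_names (A :: l)).
Proof. now apply incl_appr, incl_appl. Qed.

Lemma threshold_names_tail A l :
  incl (threshold_names l) (threshold_names (A :: l)).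
Proof. simpl. now do 2 apply incl_appr. Qed.

Lemma grounded_threshold_names l l' :
  grounded E l' -> incl l base -> grounded E (threshold_names l ++ l').
Proof.
  intros hl'. induction l as [|A l IH]; intros hl; simpl.
  - rewrite app_nil_r. apply grounded_prepend; [|exact hl'].
    intros X hX. apply in_map_iff in hX as ([|k] & <- & _); easy.
  - apply incl_cons_inv in hl as [hA hl]. rewrite <- !app_assoc.
    apply grounded_prepend.
    + intros X hX. apply in_map_iff in hX as ([|k] & <- & hk); [easy|].
      apply in_seq in hk. rewrite app_assoc. apply incl_appl.
      apply incl_cons; [|apply incl_cons; [|easy]]; apply in_or_app.
      * right. apply threshold_names_in. lia.
      * left. apply threshold_conjunctions_in; [exact hA|lia].
    + apply grounded_ands; auto.
      intros k hk. apply in_seq in hk. apply in_or_app; left.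
      apply threshold_names_in. lia.
Qed.

Lemma grounded_literal_names : grounded E literal_names.
Proof.
  assert (hremove : forall l l', grounded E l' -> grounded E
    (flat_map (fun A => threshold_names (remove_first A L)) l ++ l')).
  { induction l as [|A l IH]; intros l' hl'; [exact hl'|].
    simpl. rewrite <- app_assoc.
    apply grounded_threshold_names; [now apply IH|].
    apply incl_tran with (2 := L_base), remove_first_incl. }
  now apply hremove, grounded_threshold_names.
Qed.

Lemma literal_names_base : incl (map CF base) literal_names.
Proof. now do 2 apply incl_appr. Qed.

Lemma literal_names_threshold : incl (threshold_names L) literal_names.
Proof. now apply incl_appr, incl_appl. Qed.

Lemma literal_names_remove A :
  In A L -> incl (threshold_names (remove_first A L)) literal_names.
Proof.
  intros hA X hX. apply in_or_app; left. apply in_flat_map. eauto.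
Qed.

Lemma value_names_in k Q b :
  k < slices -> incl (query_atoms Q) L ->
  In (value L k Q b) (value_names k Q b).
Proof.
  intros hk. revert b.
  induction Q as [A|Q IH|Q IHQ R IHR|Q IHQ R IHR]; intros b hQ; simpl in *;
    auto; try apply incl_app_inv in hQ as [hQ hR].
  - apply incl_cons_inv in hQ as [hA _]. destruct b.
    + apply literal_names_base. auto using in_map.
    + apply literal_names_remove with A; auto using threshold_names_in.
  - destruct b; [apply in_eq|]; auto using and_names_in.
  - destruct b; [|apply in_eq]; auto using and_names_in.
Qed.

Lemma grounded_value_names k Q b :
  k < slices -> incl (query_atoms Q) L -> grounded E (value_names k Q b).
Proof.
  intros hk. revert b.
  induction Q as [A|Q IH|Q IHQ R IHR|Q IHQ R IHR]; intros b hQ; simpl in *;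
    auto using grounded_literal_names;
    apply incl_app_inv in hQ as [hQ hR];
    destruct b;
    first [apply grounded_or_names|apply grounded_and];
    auto using value_names_in.
Qed.

Section QueryNames.
Variable queries : list query.
Hypothesis queries_atoms :
  forall Q, In Q queries -> incl (query_atoms Q) L.

Lemma grounded_query_names : grounded E (query_names queries).
Proof.
  apply grounded_app; [|apply grounded_literal_names].
  apply grounded_flat_map. intros k hk. apply in_seq in hk.
  apply grounded_flat_map. intros Q hQ.
  apply grounded_app; apply grounded_value_names; auto; lia.
Qed.

Lemma query_names_literal : incl literal_names (query_names queries).
Proof. now apply incl_appr. Qed.

Lemma query_names_value k Q b :
  k < slices -> In Q queries -> In (value L k Q b) (query_names queries).
Proof.
  intros hk hQ. apply in_or_app; left.
  apply in_flat_map. exists k. split; [apply in_seq; lia|].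
  apply in_flat_map. exists Q. split; [exact hQ|]. apply in_or_app.
  destruct b; auto using value_names_in.
Qed.
End QueryNames.
End Names.

(** * Entailments between names *)

Definition short_sides (F : list fml) : list (list fml) :=
  [] :: map (fun A => [A]) F ++
  map (fun AB => [fst AB; snd AB]) (list_prod F F).

Definition short_sequents (F : list fml) : list sequent :=
  list_prod (short_sides F) (short_sides F).

Lemma short_sides_in F G : incl G F -> length G <= 2 -> In G (short_sides F).
Proof.
  destruct G as [|A [|B [|C G]]]; simpl; intros hG hl; [auto| | |lia]; right;
    apply in_or_app; apply incl_cons_inv in hG as [hA hG].
  - left. now apply (in_map (fun A => [A])).
  - right. apply incl_cons_inv in hG as [hB _].
    apply (in_map (fun AB => [fst AB; snd AB]) _ (A, B)). now apply in_prod.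
Qed.

Lemma short_sides_inv F G : In G (short_sides F) -> incl G F /\ length G <= 2.
Proof.
  intros [<-|h]; [simpl; split; [easy|lia]|].
  apply in_app_or in h as [h|h]; apply in_map_iff in h as (x & <- & h).
  - split; [now apply incl_cons|simpl; lia].
  - destruct x as [A B]. apply in_prod_iff in h as [hA hB].
    split; [|simpl; lia]. now repeat apply incl_cons.
Qed.

Definition cut_depth : nat := 8.

Section Entailment.
Variables (E E' : axiom_list) (name : cfml -> nat) (base : list fml).
Variables (names : list cfml) (proved : sequent -> Prop) (z : nat).

Hypothesis base_grounded : grounded E (map CF base).
Hypothesis base_size : forall A, In A base -> fml_size A <= z.
Hypothesis base_axioms :
  forall i, In (FExt i) base -> in_axioms E' i (nth i E F0).
Hypothesis names_grounded : grounded E names.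
Hypothesis base_named : incl (map CF base) names.
Hypothesis names_axioms : forall X, In X names -> is_name E E' name X.
Hypothesis z_ge : 3 <= z.

Notation nm X := (FExt (name X)).

Definition key_fmls : list fml := base ++ map (fun X => nm X) names.

Hypothesis proved_short : forall G D,
  In (G, D) (short_sequents key_fmls) ->
  cut_tree E' z proved cut_depth G D -> proved (G, D).

Definition entails (G D : list fml) : Prop := available E' proved (G, D).

Definition equivalent (A B : fml) : Prop :=
  entails [A] [B] /\ entails [B] [A].

Definition disjunction (C A B : fml) : Prop :=
  entails [C] [A; B] /\ entails [A] [C] /\ entails [B] [C].

Definition conjunction (C A B : fml) : Prop :=
  entails [C] [A] /\ entails [C] [B] /\ entails [A; B] [C].

Definition decision (C A : fml) (p : nat) (B : fml) : Prop :=
  (entails [A] [pvar p; C] /\ entails [pvar p; B] [C]) /\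
  entails [C] [A; pvar p] /\ entails [pvar p; C] [B].

Lemma entails_id A : entails [A] [A].
Proof. left. constructor. Qed.

Lemma entails_0 : entails [F0] [].
Proof. left. constructor. Qed.

Lemma entails_1 : entails [] [F1].
Proof. left. constructor. Qed.

Lemma disjunction_or A B : disjunction (FOr A B) A B.
Proof. repeat split; left; constructor. Qed.

Lemma decision_dec A p B : decision (FDec A p B) A p B.
Proof. repeat split; left; constructor. Qed.

Lemma equivalent_axiom i A : in_axioms E' i A -> equivalent (FExt i) A.
Proof. intros h. split; left; now constructor. Qed.

Lemma equivalent_shape X :
  In X names -> equivalent (nm X) (shape_fml name (expansion E X)).
Proof. intros hX. now apply equivalent_axiom, names_axioms. Qed.

Lemma entails_of_cut_tree G D :
  incl (G ++ D) key_fmls -> length G <= 2 -> length D <= 2 ->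
  cut_tree E' z proved cut_depth G D -> entails G D.
Proof.
  intros hi hG hD h. apply incl_app_inv in hi as [hiG hiD].
  right. apply proved_short; [|exact h].
  now apply in_prod; apply short_sides_in.
Qed.

Lemma key_base A : In A base -> In A key_fmls.
Proof. intros; apply in_or_app; auto. Qed.

Lemma key_name X : In X names -> In (nm X) key_fmls.
Proof.
  intros; apply in_or_app; right. now apply (in_map (fun X => nm X)).
Qed.

Ltac member :=
  solve [repeat first [simple apply in_eq | assumption | simple apply in_cons]].
Ltac included := repeat (apply incl_cons; [member|]); apply incl_nil_l.
Ltac leaf :=
  match goal with
  | H : entails _ _ |- _ => solve [apply (cut_leaf _ _ _ _ _ _ _ _ H); included]
  end.
Ltac cut_on_each fs :=
  first
    [ leaf
    | lazymatch fs with
      | cons ?f ?fs' =>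
          pose proof (entails_id f);
          apply (cut_node _ _ _ _ f);
          [solve [auto | cbn [fml_size pvar]; lia]
          |cut_on_each fs'|cut_on_each fs']
      end ].
Ltac split_tables :=
  repeat match goal with
  | H : equivalent _ _ |- _ => destruct H
  | H : disjunction _ _ _ |- _ => destruct H as (? & ? & ?)
  | H : conjunction _ _ _ |- _ => destruct H as (? & ? & ?)
  | H : decision _ _ _ _ |- _ => destruct H as ((? & ?) & ? & ?)
  end.
(* Cut on the formulas [fs] in turn, closing a branch as soon as it contains
   the formulas of an entailment in the context. *)
Ltac cut_on fs := split_tables; cut_on_each fs.
Ltac entail_by_cuts fs :=
  split_tables; repeat split;
  (apply entails_of_cut_tree;
   [repeat (apply incl_cons; [solve [auto using key_base, key_name]|]);
    apply incl_nil_l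
   |simpl; lia|simpl; lia|unfold cut_depth; cut_on_each fs]).

Lemma disjunction_name X Y :
  In (COr X Y) names -> disjunction (nm (COr X Y)) (nm X) (nm Y).
Proof.
  intros h. pose proof (equivalent_shape _ h) as he. simpl in he.
  pose proof (grounded_closed _ _ _ names_grounded h) as hc.
  apply incl_cons_inv in hc as [hX hc]. apply incl_cons_inv in hc as [hY _].
  pose proof (disjunction_or (nm X) (nm Y)).
  entail_by_cuts [FOr (nm X) (nm Y)].
Qed.

Lemma conjunction_name X Y :
  In X names -> In Y names -> In (CAnd X Y) names ->
  conjunction (nm (CAnd X Y)) (nm X) (nm Y).
Proof.
  intros hX hY. revert X hX.
  apply (grounded_induction E (fun X => In (CAnd X Y) names ->
    conjunction (nm (CAnd X Y)) (nm X) (nm Y)) names names_grounded).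
  intros X hX IH hXY.
  pose proof (equivalent_shape _ hX) as eX.
  pose proof (equivalent_shape _ hXY) as eXY. simpl in eXY.
  pose proof (grounded_closed _ _ _ names_grounded hX) as cX.
  pose proof (grounded_closed _ _ _ names_grounded hXY) as cXY.
  pose proof entails_0. pose proof entails_1. pose proof (entails_id (nm Y)).
  unfold children in *. simpl in cXY.
  destruct (expansion E X) as [| |U|U W|U p W]; simpl in *;
    repeat match goal with
    | H : incl (_ :: _) _ |- _ => apply incl_cons_inv in H as [? H]
    end.
  - entail_by_cuts [F0].
  - entail_by_cuts [F1].
  - pose proof (IH U ltac:(auto) ltac:(auto)).
    entail_by_cuts [nm U; nm Y; nm (CAnd U Y)].
  - pose proof (IH U ltac:(auto) ltac:(auto)).
    pose proof (IH W ltac:(auto) ltac:(auto)).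
    pose proof (disjunction_or (nm U) (nm W)).
    pose proof (disjunction_or (nm (CAnd U Y)) (nm (CAnd W Y))).
    entail_by_cuts [FOr (nm (CAnd U Y)) (nm (CAnd W Y)); FOr (nm U) (nm W);
      nm (CAnd U Y); nm (CAnd W Y); nm U; nm W].
  - pose proof (IH U ltac:(auto) ltac:(auto)).
    pose proof (IH W ltac:(auto) ltac:(auto)).
    pose proof (decision_dec (nm U) p (nm W)).
    pose proof (decision_dec (nm (CAnd U Y)) p (nm (CAnd W Y))).
    entail_by_cuts [FDec (nm (CAnd U Y)) p (nm (CAnd W Y));
      FDec (nm U) p (nm W); pvar p;
      nm (CAnd U Y); nm (CAnd W Y); nm U; nm W].
Qed.

Lemma base_children A B :
  In A base -> In (CF B) (children E (CF A)) -> In B base.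
Proof.
  intros hA hB. apply (in_map CF) in hA.
  apply (grounded_closed _ _ _ base_grounded hA) in hB.
  apply in_map_iff in hB as (C & [= ->] & hB). exact hB.
Qed.

Lemma base_or A B : In (FOr A B) base -> In A base /\ In B base.
Proof. intros h. split; apply base_children with (1 := h); simpl; auto. Qed.

Lemma base_dec A p B : In (FDec A p B) base -> In A base /\ In B base.
Proof. intros h. split; apply base_children with (1 := h); simpl; auto. Qed.

Lemma base_unfold i : In (FExt i) base -> In (nth i E F0) base.
Proof. intros h. apply base_children with (1 := h). now left. Qed.

Lemma base_name A : In A base -> In (CF A) names.
Proof. intros h. now apply base_named, in_map. Qed.

Lemma equivalent_base A : In A base -> equivalent (nm (CF A)) A.
Proof.
  intros hA. apply (grounded_induction E
    (fun X => forall A, X = CF A -> equivalent (nm X) A) (map CF base))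
    with (X := CF A); auto using in_map.
  clear A hA. intros X hX IH A ->.
  assert (hA : In A base) by (now apply in_map_iff in hX as (B & [= ->] & hB)).
  pose proof (base_name _ hA). pose proof (equivalent_shape (CF A)) as e.
  pose proof entails_0. pose proof entails_1.
  destruct A as [| |B p C|B C|i]; simpl in *.
  - now apply e.
  - now apply e.
  - apply base_dec in hA as hBC. destruct hBC as [hB hC].
    pose proof (IH (CF B) ltac:(simpl; auto) B eq_refl).
    pose proof (IH (CF C) ltac:(simpl; auto) C eq_refl).
    pose proof (decision_dec B p C).
    pose proof (decision_dec (nm (CF B)) p (nm (CF C))).
    specialize (e ltac:(assumption)).
    entail_by_cuts [FDec (nm (CF B)) p (nm (CF C)); pvar p;
      nm (CF B); nm (CF C); B; C].
  - apply base_or in hA as hBC. destruct hBC as [hB hC].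
    pose proof (IH (CF B) ltac:(simpl; auto) B eq_refl).
    pose proof (IH (CF C) ltac:(simpl; auto) C eq_refl).
    pose proof (disjunction_or B C).
    pose proof (disjunction_or (nm (CF B)) (nm (CF C))).
    specialize (e ltac:(assumption)).
    entail_by_cuts [FOr (nm (CF B)) (nm (CF C)); nm (CF B); nm (CF C); B; C].
  - pose proof (IH (CF (nth i E F0)) ltac:(now left) _ eq_refl).
    pose proof (base_unfold _ hA).
    pose proof (equivalent_axiom _ _ (base_axioms _ hA)).
    specialize (e ltac:(assumption)).
    entail_by_cuts [nm (CF (nth i E F0)); nth i E F0].
Qed.

Lemma entails_of_simulates A B :
  simulates E A B -> In A base -> In B base -> entails [B] [A].
Proof.
  assert (hnth : forall i A, in_axioms E i A -> nth i E F0 = A)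
    by (intros; now apply nth_error_nth).
  intros h. induction h as [A|A C D hAC IHC hAD IHD|A i A' hi h IH
    |A p B C D hAC IHC hBD IHD|A0 A1 B h IH|A0 A1 B h IH|i A' B hi h IH];
    intros hA hB.
  - apply entails_id.
  - destruct (base_or _ _ hB) as [hC hD].
    pose proof (IHC hA hC). pose proof (IHD hA hD).
    pose proof (disjunction_or C D). entail_by_cuts [C; D].
  - pose proof (base_axioms _ hB) as e. pose proof (base_unfold _ hB) as hA'.
    rewrite (hnth _ _ hi) in *. pose proof (equivalent_axiom _ _ e).
    pose proof (IH hA hA'). entail_by_cuts [A'].
  - destruct (base_dec _ _ _ hA), (base_dec _ _ _ hB).
    pose proof (IHC ltac:(auto) ltac:(auto)).
    pose proof (IHD ltac:(auto) ltac:(auto)).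
    pose proof (decision_dec A p B). pose proof (decision_dec C p D).
    entail_by_cuts [pvar p; C; D; A; B].
  - destruct (base_or _ _ hA) as [hA0 hA1]. pose proof (IH hA0 hB).
    pose proof (disjunction_or A0 A1). entail_by_cuts [A0].
  - destruct (base_or _ _ hA) as [hA0 hA1]. pose proof (IH hA1 hB).
    pose proof (disjunction_or A0 A1). entail_by_cuts [A1].
  - pose proof (base_axioms _ hA) as e. pose proof (base_unfold _ hA) as hA'.
    rewrite (hnth _ _ hi) in *. pose proof (equivalent_axiom _ _ e).
    pose proof (IH hA' hB). entail_by_cuts [A'].
Qed.

Variable L : list fml.
Hypothesis L_base : incl L base.
Hypothesis literals_named : incl (literal_names base L) names.

Notation thr l k := (nm (threshold l k)).

Definition thresholds_named (l : list fml) : Prop :=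
  incl (threshold_names base L l) names.

Lemma threshold_named l k :
  k < slices L -> thresholds_named l -> In (threshold l k) names.
Proof. intros hk hl. now apply hl, threshold_names_in. Qed.

Lemma thresholds_named_tail A l :
  thresholds_named (A :: l) -> thresholds_named l.
Proof. apply incl_tran, threshold_names_tail. Qed.

Lemma thresholds_named_atoms : thresholds_named L.
Proof. apply incl_tran with (2 := literals_named), literal_names_threshold. Qed.

Lemma thresholds_named_remove A :
  In A L -> thresholds_named (remove_first A L).
Proof.
  intros hA. apply incl_tran with (2 := literals_named).
  now apply literal_names_remove.
Qed.

Lemma equivalent_threshold_0 l :
  thresholds_named l -> equivalent (thr l 0) F1.
Proof.
  intros hl.
  assert (h : In (threshold l 0) names)
    by (apply threshold_named; [unfold slices; lia|exact hl]).
  pose proof (equivalent_shape _ h). now destruct l.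
Qed.

Lemma threshold_cons A l k :
  In A L -> S k < slices L -> thresholds_named (A :: l) ->
  let both := nm (CAnd (CF A) (threshold l k)) in
  disjunction (thr (A :: l) (S k)) (thr l (S k)) both /\
  conjunction both (nm (CF A)) (thr l k).
Proof.
  intros hA hk hl. split.
  - apply disjunction_name. now apply (threshold_named (A :: l) (S k)).
  - pose proof (thresholds_named_tail _ _ hl).
    apply conjunction_name; auto using base_name.
    + apply threshold_named; auto using Nat.lt_succ_l.
    + apply hl, threshold_names_conjunctions, threshold_conjunctions_in;
        auto using Nat.lt_succ_l.
Qed.

Lemma threshold_insert A l1 l2 k :
  In A L -> incl l1 L -> S k < slices L ->
  thresholds_named (l1 ++ A :: l2) -> thresholds_named (l1 ++ l2) ->
  entails [nm (CF A); thr (l1 ++ l2) k] [thr (l1 ++ A :: l2) (S k)].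
Proof.
  intros hA. pose proof (base_name _ (L_base _ hA)). revert k.
  induction l1 as [|B l1 IH]; intros k hl1 hk hl hl';
    pose proof (threshold_named _ _ hk hl);
    pose proof (threshold_named _ _ (Nat.lt_succ_l _ _ hk) hl');
    simpl app in *.
  - destruct (threshold_cons A l2 k hA hk hl).
    entail_by_cuts [nm (CAnd (CF A) (threshold l2 k))].
  - apply incl_cons_inv in hl1 as [hB hl1].
    pose proof (thresholds_named_tail _ _ hl) as tl.
    pose proof (thresholds_named_tail _ _ hl') as tl'.
    destruct (threshold_cons B (l1 ++ A :: l2) k hB hk hl).
    pose proof (IH k hl1 hk tl tl').
    destruct k as [|k].
    + pose proof (equivalent_threshold_0 _ hl').
      pose proof (equivalent_threshold_0 _ tl').
      entail_by_cuts [F1; thr (l1 ++ l2) 0; thr (l1 ++ A :: l2) 1].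
    + apply Nat.lt_succ_l in hk.
      destruct (threshold_cons B (l1 ++ l2) k hB hk hl').
      pose proof (IH k hl1 hk tl tl').
      entail_by_cuts [thr (l1 ++ l2) (S k);
        nm (CAnd (CF B) (threshold (l1 ++ l2) k));
        nm (CF B); thr (l1 ++ l2) k; thr (l1 ++ A :: l2) (S k);
        thr (l1 ++ A :: l2) (S (S k));
        nm (CAnd (CF B) (threshold (l1 ++ A :: l2) (S k)))].
Qed.

Lemma threshold_delete A l1 l2 k :
  In A L -> incl l1 L -> k < slices L ->
  thresholds_named (l1 ++ A :: l2) -> thresholds_named (l1 ++ l2) ->
  entails [thr (l1 ++ A :: l2) k] [nm (CF A); thr (l1 ++ l2) k].
Proof.
  intros hA. pose proof (base_name _ (L_base _ hA)). revert k.
  induction l1 as [|B l1 IH]; intros k hl1 hk hl hl';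
    pose proof (threshold_named _ _ hk hl);
    pose proof (threshold_named _ _ hk hl');
    (destruct k as [|k];
     [pose proof (equivalent_threshold_0 _ hl'); pose proof entails_1;
      entail_by_cuts [F1]|]);
    simpl app in *.
  - destruct (threshold_cons A l2 k hA hk hl).
    entail_by_cuts [thr l2 (S k); nm (CAnd (CF A) (threshold l2 k))].
  - apply incl_cons_inv in hl1 as [hB hl1].
    destruct (threshold_cons B (l1 ++ A :: l2) k hB hk hl).
    destruct (threshold_cons B (l1 ++ l2) k hB hk hl').
    apply thresholds_named_tail in hl, hl'.
    pose proof (IH (S k) hl1 hk hl hl').
    pose proof (IH k hl1 (Nat.lt_succ_l _ _ hk) hl hl').
    entail_by_cuts [thr (l1 ++ A :: l2) (S k);
      nm (CAnd (CF B) (threshold (l1 ++ A :: l2) k)); nm (CF B);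
      thr (l1 ++ A :: l2) k; thr (l1 ++ l2) k;
      thr (l1 ++ l2) (S k); nm (CAnd (CF B) (threshold (l1 ++ l2) k))].
Qed.

Lemma threshold_unsatisfiable l k :
  incl l L -> thresholds_named l -> length l < k -> k < slices L ->
  entails [thr l k] [].
Proof.
  revert k. induction l as [|A l IH]; intros [|k] hl hnamed h hk; try easy;
    pose proof (threshold_named _ _ hk hnamed) as hname.
  - pose proof (equivalent_shape _ hname) as e. simpl in e.
    pose proof entails_0. entail_by_cuts [F0].
  - apply incl_cons_inv in hl as [hA hl]. simpl in h.
    destruct (threshold_cons A l k hA hk hnamed).
    apply thresholds_named_tail in hnamed.
    pose proof (IH k hl hnamed ltac:(lia) ltac:(lia)).
    pose proof (IH (S k) hl hnamed ltac:(lia) ltac:(lia)).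
    entail_by_cuts [thr l (S k); nm (CAnd (CF A) (threshold l k)); thr l k].
Qed.

Variable queries : list query.
Hypothesis queries_closed :
  forall Q, In Q queries -> incl (components Q) queries.
Hypothesis queries_atoms :
  forall Q, In Q queries -> incl (query_atoms Q) L.
Hypothesis values_named :
  forall k Q b, k < slices L -> In Q queries -> In (value L k Q b) names.

Definition state_names (k : nat) (st : state) : list fml :=
  map (fun a => nm (value L k (fst a) (snd a))) st.

Section Slice.
Variable k : nat.
Hypothesis k_slice : S k < slices L.

Notation val Q b := (value L k Q b).
Notation values st := (state_names k st).

Lemma low_threshold_named : In (threshold L k) names.
Proof.
  apply threshold_named; [now apply Nat.lt_succ_l|exact thresholds_named_atoms].
Qed.

Lemma high_threshold_named : In (threshold L (S k)) names.
Proof. apply threshold_named; [exact k_slice|exact thresholds_named_atoms]. Qed.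

Lemma value_named Q b : In Q queries -> In (val Q b) names.
Proof. apply values_named. now apply Nat.lt_succ_l. Qed.

Definition complementary (X X' : cfml) : Prop :=
  entails [thr L k] [nm X; nm X'] /\ entails [nm X; nm X'] [thr L (S k)].

Lemma complementary_literal A :
  In A L -> complementary (CF A) (threshold (remove_first A L) k).
Proof.
  intros hA.
  destruct (remove_first_split A L hA) as (l1 & l2 & e & er).
  assert (hl1 : incl l1 L) by (rewrite e; apply incl_appl, incl_refl).
  pose proof (threshold_insert A l1 l2 k hA hl1) as hins.
  pose proof (threshold_delete A l1 l2 k hA hl1) as hdel.
  rewrite <- e, <- er in hins, hdel.
  split; [apply hdel|apply hins];
    auto using Nat.lt_succ_l, thresholds_named_atoms, thresholds_named_remove.
Qed.

Lemma complementary_sym X X' :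
  In X names -> In X' names -> complementary X X' -> complementary X' X.
Proof.
  intros hX hX' []. pose proof low_threshold_named.
  pose proof high_threshold_named. entail_by_cuts (@nil fml).
Qed.

Lemma complementary_or_and X X' Y Y' :
  In (COr X Y) names -> In X' names -> In Y' names -> In (CAnd X' Y') names ->
  complementary X X' -> complementary Y Y' ->
  complementary (COr X Y) (CAnd X' Y').
Proof.
  intros hor hX' hY' hand [] [].
  pose proof low_threshold_named. pose proof high_threshold_named.
  pose proof (disjunction_name X Y hor).
  pose proof (conjunction_name X' Y' hX' hY' hand).
  entail_by_cuts [nm X; nm Y; nm X'; nm Y'].
Qed.

Lemma complementary_value Q :
  In Q queries -> complementary (val Q true) (val Q false).
Proof.
  induction Q as [A|Q IH|Q IHQ R IHR|Q IHQ R IHR]; intros hQ;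
    pose proof (value_named _ true hQ) as hQ1;
    pose proof (value_named _ false hQ) as hQ0;
    pose proof (queries_atoms _ hQ) as hatoms;
    apply queries_closed in hQ; simpl in hQ, hQ0, hQ1;
    repeat (apply incl_cons_inv in hQ as [? hQ]).
  - apply complementary_literal, hatoms, in_eq.
  - apply complementary_sym; auto using value_named.
  - apply complementary_or_and; auto using value_named.
  - apply complementary_sym; auto.
    apply complementary_or_and; auto using value_named;
      apply complementary_sym; auto using value_named.
Qed.

Lemma complementary_value_negb Q b :
  In Q queries -> complementary (val Q b) (val Q (negb b)).
Proof.
  intros hQ. destruct b; simpl; [now apply complementary_value|].
  apply complementary_sym; auto using value_named, complementary_value.
Qed.

Lemma state_names_in st Q b : In (Q, b) st -> In (nm (val Q b)) (values st).
Proof.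
  intros h. exact (in_map (fun a => nm (val (fst a) (snd a))) _ _ h).
Qed.

Lemma atom_base A : In (QF A) queries -> In A base.
Proof. intros h. apply L_base, (queries_atoms _ h). now left. Qed.

Lemma cut_literal A b n G D :
  In (QF A) queries -> In (nm (val (QF A) b)) G -> In (thr L (S k)) D ->
  cut_tree E' z proved n (if b then A :: G else G) (if b then D else A :: D) ->
  cut_tree E' z proved (2 + n) G D.
Proof.
  intros hQ hG hD h.
  pose proof (atom_base _ hQ) as hA.
  pose proof (equivalent_base _ hA). destruct (complementary_value _ hQ).
  apply cut_tree_le with (n' := S n) in h; [|lia].
  destruct b; apply (cut_node _ _ _ _ A); auto; cut_on [nm (CF A)].
Qed.

Lemma cut_literals G0 D0 : forall n G D,
  (forall A b, In (QF A, b) (initial_state G0 D0) ->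
    In (QF A) queries /\ In (nm (val (QF A) b)) G) ->
  In (thr L (S k)) D ->
  cut_tree E' z proved n (G0 ++ G) (D0 ++ D) ->
  cut_tree E' z proved (2 * (length G0 + length D0) + n) G D.
Proof.
  induction G0 as [|A G0 IH]; intros n G D hlit hD h.
  - revert n G D hlit hD h.
    induction D0 as [|A D0 IH]; intros n G D hlit hD h; [exact h|].
    destruct (hlit A false) as [hQ hG]; [now left|].
    replace (2 * (length [] + length (A :: D0)) + n)
      with (2 + (2 * (length D0) + n)) by (simpl; lia).
    apply (cut_literal A false); auto. apply IH; auto with datatypes.
    + intros B b hB. apply hlit. now right.
    + apply cut_tree_weakening with (1 := h); [apply incl_refl|].
      intros B hB. simpl in *. rewrite in_app_iff in *. simpl. tauto.
  - destruct (hlit A true) as [hQ hG]; [now left|].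
    replace (2 * (length (A :: G0) + length D0) + n)
      with (2 + (2 * (length G0 + length D0) + n)) by (simpl; lia).
    apply (cut_literal A true); auto. apply IH; auto.
    + intros B b hB. split; [apply (hlit B b); now right|].
      right. apply hlit. now right.
    + apply cut_tree_weakening with (1 := h); [|apply incl_refl].
      intros B hB. simpl in *. rewrite in_app_iff in *. simpl. tauto.
Qed.

Section State.
Variable st : state.
Hypothesis st_queries : forall Q b, In (Q, b) st -> In Q queries.

Definition refutable : Prop :=
  cut_tree E' z proved cut_depth (values st) [thr L (S k)].

Lemma refutable_entailment G0 D0 :
  entails G0 D0 -> incl (initial_state G0 D0) st ->
  length G0 + length D0 <= 4 -> refutable.
Proof.
  intros h hi hl.
  apply cut_tree_le with (2 * (length G0 + length D0) + 0);
    [|unfold cut_depth; lia].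
  apply cut_literals.
  - intros A b hA. apply hi in hA. split; eauto using state_names_in.
  - apply in_eq.
  - apply cut_leaf with G0 D0; auto; apply incl_appl, incl_refl.
Qed.

Lemma refutable_complements Q b :
  In Q queries -> In (nm (val Q b)) (values st) ->
  In (nm (val Q (negb b))) (values st) -> refutable.
Proof.
  intros hQ h h'. destruct (complementary_value_negb Q b hQ).
  cut_on (@nil fml).
Qed.

Lemma refutable_or P Q R b :
  components P = [Q; R] -> value L k P b = COr (val Q b) (val R b) ->
  In (P, b) st -> In (Q, negb b) st -> In (R, negb b) st -> refutable.
Proof.
  intros hc hv hP hQ hR.
  pose proof (value_named P b (st_queries _ _ hP)) as hor. rewrite hv in hor.
  pose proof (disjunction_name _ _ hor).
  destruct (complementary_value_negb Q b (st_queries _ _ hQ)).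
  destruct (complementary_value_negb R b (st_queries _ _ hR)).
  apply state_names_in in hP, hQ, hR. rewrite hv in hP.
  unfold refutable, cut_depth. cut_on [nm (val Q b); nm (val R b)].
Qed.

Lemma refutable_and P Q R (i b : bool) :
  components P = [Q; R] -> value L k P b = CAnd (val Q b) (val R b) ->
  In (P, b) st -> In (if i then R else Q, negb b) st -> refutable.
Proof.
  intros hc hv hP hi.
  pose proof (queries_closed P (st_queries _ _ hP)) as hQR. rewrite hc in hQR.
  apply incl_cons_inv in hQR as [hQ hR]. apply incl_cons_inv in hR as [hR _].
  pose proof (value_named P b (st_queries _ _ hP)) as hand. rewrite hv in hand.
  pose proof (conjunction_name (val Q b) (val R b) ltac:(auto using value_named)
    ltac:(auto using value_named) hand).
  destruct (complementary_value_negb Q b hQ).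
  destruct (complementary_value_negb R b hR).
  apply state_names_in in hP, hi. rewrite hv in hP.
  unfold refutable, cut_depth.
  destruct i; cut_on [nm (val Q b); nm (val R b)].
Qed.

Ltac by_entailment h :=
  apply refutable_entailment with (1 := h);
  [eapply incl_tran; [|eassumption]; intros ? ?; simpl in *; tauto
  |simpl; lia].

Lemma refutable_contradiction C :
  simple_contradiction E C -> incl C st -> refutable.
Proof.
  intros h hi.
  assert (hbase : forall A b, In (QF A, b) C -> In A base)
    by eauto using atom_base.
  destruct h as [| |A0 A1 p b0 b1 i c hc|Q b|P Q0 Q1 i hor|P Q0 Q1 hor
    |Q0 Q1|Q0 Q1 i|i A b hA|A B hs].
  - by_entailment entails_0.
  - by_entailment entails_1.
  - destruct (decision_dec A0 p A1) as ((h0 & h1) & h2 & h3).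
    destruct i, b0, b1, c; try congruence;
      first [by_entailment h0|by_entailment h1
            |by_entailment h2|by_entailment h3].
  - apply refutable_complements with Q b;
      [eauto with datatypes|auto using state_names_in with datatypes|].
    apply (state_names_in st (QNeg Q) b), hi, in_cons, in_eq.
  - destruct hor as [A B|Q R].
    + destruct (disjunction_or A B) as (_ & h0 & h1).
      destruct i; [by_entailment h1|by_entailment h0].
    + apply (refutable_and (QOr Q R) Q R i false); auto with datatypes.
  - destruct hor as [A B|Q R].
    + by_entailment (proj1 (disjunction_or A B)).
    + apply (refutable_or (QOr Q R) Q R true); auto with datatypes.
  - apply (refutable_or (QAnd Q0 Q1) Q0 Q1 false); auto with datatypes.
  - apply (refutable_and (QAnd Q0 Q1) Q0 Q1 i true); auto with datatypes.
  - pose proof (base_axioms i (hbase (FExt i) b (in_eq _ _))) as hE'.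
    rewrite (nth_error_nth _ _ F0 hA) in hE'.
    destruct (equivalent_axiom _ _ hE') as [h0 h1].
    destruct b; [by_entailment h0|by_entailment h1].
  - by_entailment (entails_of_simulates A B hs (hbase A false (in_eq _ _))
      (hbase B true (in_cons _ _ _ (in_eq _ _)))).
Qed.
End State.
End Slice.

(** * From winning strategies to derivations *)

Fixpoint tails (l : state) : list state :=
  l :: match l with [] => [] | _ :: l => tails l end.

Fixpoint strategy_states (st : state) (T : strategy) : list state :=
  st :: match T with
       | SLeaf => []
       | SNode Q T0 T1 =>
           strategy_states ((Q, false) :: st) T0 ++
           strategy_states ((Q, true) :: st) T1
       end.

Fixpoint strategy_queries (T : strategy) : list query :=
  match T with
  | SLeaf => []
  | SNode Q T0 T1 => Q :: strategy_queries T0 ++ strategy_queries T1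
  end.

Variables (Gamma Delta : list fml) (T : strategy).

Definition slice_sequent (k : nat) (st : state) : sequent :=
  (thr L k :: state_names k st ++ Gamma, thr L (S k) :: Delta).

Definition game_states : list state :=
  strategy_states (initial_state Gamma Delta) T ++
  tails (initial_state Gamma Delta).

Definition game_sequents : list sequent :=
  map (fun kst => slice_sequent (fst kst) (snd kst))
    (list_prod (seq 0 (slices L)) game_states) ++
  map (fun k => (Gamma, thr L k :: Delta)) (seq 0 (slices L)) ++
  [(Gamma, Delta)].

Hypothesis contexts_queries :
  forall A, In A (Gamma ++ Delta) -> In (QF A) queries.
Hypothesis T_queries : incl (strategy_queries T) queries.
Hypothesis proved_game : forall G D,
  In (G, D) game_sequents ->
  cut_tree E' z proved cut_depth G D -> proved (G, D).

Lemma slice_intro k st :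
  k < slices L -> In st game_states ->
  cut_tree E' z proved cut_depth
    (thr L k :: state_names k st ++ Gamma)
    (thr L (S k) :: Delta) ->
  proved (slice_sequent k st).
Proof.
  intros hk hst. apply proved_game, in_or_app. left.
  apply (in_map (fun kst => slice_sequent (fst kst) (snd kst)) _ (k, st)).
  apply in_prod; [apply in_seq; lia|exact hst].
Qed.

Lemma slice_of_winning k U : S k < slices L -> forall st,
  (forall Q b, In (Q, b) st -> In Q queries) ->
  incl (strategy_queries U) queries ->
  incl (strategy_states st U) game_states ->
  winning E st U -> proved (slice_sequent k st).
Proof.
  intros hk. induction U as [|Q U0 IH0 U1 IH1]; intros st hst hU hstates hwin;
    (apply slice_intro; [lia|apply hstates, in_eq|]).
  - destruct hwin as (C & hC & hi).
    apply cut_tree_weakening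
      with (1 := refutable_contradiction k hk st hst C hC hi).
    + apply incl_tl, incl_appl, incl_refl.
    + apply incl_cons; [apply in_eq|easy].
  - destruct hwin as [w0 w1]. simpl in hU, hstates.
    apply incl_cons_inv in hU as [hQ hU]. apply incl_app_inv in hU as [hU0 hU1].
    apply incl_cons_inv in hstates as [_ hstates].
    apply incl_app_inv in hstates as [hs0 hs1].
    assert (hst' : forall c R b, In (R, b) ((Q, c) :: st) -> In R queries)
      by (intros c R b [[= <- _]|h]; eauto).
    specialize (IH0 _ (hst' false) hU0 hs0 w0).
    specialize (IH1 _ (hst' true) hU1 hs1 w1).
    destruct (complementary_value k hk Q hQ) as [hcomplete _].
    assert (hi : forall b, incl (fst (slice_sequent k ((Q, b) :: st)))
      (nm (value L k Q b) :: fst (slice_sequent k st)))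
      by (intros b x; simpl; tauto).
    apply (cut_node _ _ _ _ (nm (value L k Q true))); [simpl; lia|..].
    + eapply cut_leaf; [right; exact IH1|apply hi|apply incl_refl].
    + apply (cut_node _ _ _ _ (nm (value L k Q false))); [simpl; lia|..].
      * eapply cut_leaf; [right; exact IH0|apply hi|apply incl_tl, incl_refl].
      * leaf.
Qed.

Lemma slice_discharge k st : S k < slices L ->
  incl st (initial_state Gamma Delta) ->
  incl (tails st) game_states ->
  proved (slice_sequent k st) -> proved (slice_sequent k []).
Proof.
  intros hk. induction st as [|[Q b] st IH]; intros hst hstates h; [exact h|].
  apply incl_cons_inv in hst as [hQ hst].
  apply incl_cons_inv in hstates as [_ hstates].
  apply IH; auto. apply slice_intro; [lia|destruct st; apply hstates, in_eq|].
  apply (cut_node _ _ _ _ (nm (value L k Q b))); [simpl; lia|..].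
  - eapply cut_leaf; [right; exact h| |apply incl_refl].
    intros A hA. simpl in *. tauto.
  - apply in_app_or in hQ as [hQ|hQ];
      apply in_map_iff in hQ as (A & [= <- <-] & hA);
      assert (hQ : In (QF A) queries)
        by (apply contexts_queries, in_or_app; auto);
      pose proof (equivalent_base A (atom_base A hQ)).
    + assert (In A (thr L k :: state_names k st ++ Gamma))
        by (right; apply in_or_app; auto).
      cut_on [nm (CF A)].
    + destruct (complementary_value k hk _ hQ).
      cut_on [nm (CF A)].
Qed.

Hypothesis T_winning : NB_proof E Gamma Delta T.

Lemma slice_root k : S k < slices L -> proved (slice_sequent k []).
Proof.
  intros hk. apply slice_discharge with (initial_state Gamma Delta);
    auto using incl_refl.
  - apply incl_appr, incl_refl.
  - apply slice_of_winning with T; auto; [|apply incl_appl, incl_refl].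
    intros Q b hQ. apply in_app_or in hQ as [hQ|hQ];
      apply in_map_iff in hQ as (A & [= <- <-] & hA);
      apply contexts_queries, in_or_app; auto.
Qed.

Lemma contexts_threshold k :
  k < slices L -> proved (Gamma, thr L k :: Delta).
Proof.
  induction k as [|k IH]; intros hk;
    (apply proved_game;
     [apply in_or_app; right; apply in_or_app; left;
      apply (in_map (fun k => (Gamma, thr L k :: Delta))), in_seq; lia|]).
  - pose proof (equivalent_threshold_0 L thresholds_named_atoms).
    pose proof entails_1. unfold cut_depth. cut_on [F1].
  - apply (cut_node _ _ _ _ (thr L k)); [simpl; lia|..].
    + eapply cut_leaf; [right; exact (slice_root k hk)|apply incl_refl..].
    + eapply cut_leaf; [right; apply IH; lia|apply incl_refl|].
      intros A hA. simpl in *. tauto.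
Qed.

Lemma contexts_proved : proved (Gamma, Delta).
Proof.
  assert (hk : length L + 1 < slices L) by (unfold slices; lia).
  pose proof (threshold_unsatisfiable L (length L + 1) (incl_refl L)
    thresholds_named_atoms ltac:(lia) hk).
  apply proved_game;
    [apply in_or_app, or_intror, in_or_app, or_intror, in_eq|].
  apply (cut_node _ _ _ _ (thr L (length L + 1))); [simpl; lia|leaf|].
  eapply cut_leaf; [right; exact (contexts_threshold _ hk)|apply incl_refl..].
Qed.
End Entailment.

(** * Queries of a game *)

Fixpoint subqueries (Q : query) : list query :=
  Q :: match Q with
       | QF _ => []
       | QNeg R => subqueries R
       | QOr R R' | QAnd R R' => subqueries R ++ subqueries R'
       end.

Lemma subqueries_refl Q : In Q (subqueries Q).
Proof. destruct Q; apply in_eq. Qed.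

Lemma components_subqueries Q : incl (components Q) (subqueries Q).
Proof.
  destruct Q; simpl; intros R hR; simpl in *; rewrite ?in_app_iff;
    intuition (subst; auto using subqueries_refl).
Qed.

Lemma subqueries_closed P Q :
  In Q (subqueries P) -> incl (components Q) (subqueries P).
Proof.
  induction P as [A|P IH|P IHP P' IHP'|P IHP P' IHP'];
    (intros [<-|h]; [apply components_subqueries|apply incl_tl]).
  - destruct h.
  - now apply IH.
  - apply in_app_or in h as [h|h]; auto using incl_appl, incl_appr.
  - apply in_app_or in h as [h|h]; auto using incl_appl, incl_appr.
Qed.

Definition queries_size (l : list query) : nat := list_sum (map query_size l).

Lemma queries_size_app l l' :
  queries_size (l ++ l') = queries_size l + queries_size l'.
Proof. unfold queries_size. now rewrite map_app, list_sum_app. Qed.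

Lemma queries_size_fmls G : queries_size (map QF G) = fmls_size G.
Proof. unfold queries_size, fmls_size. now rewrite map_map. Qed.

Lemma query_size_le_queries_size Q l : In Q l -> query_size Q <= queries_size l.
Proof.
  unfold queries_size. induction l as [|R l IH]; simpl; [easy|].
  intros [->|h]; [lia|]. specialize (IH h). lia.
Qed.

Lemma fmls_size_query_atoms Q : fmls_size (query_atoms Q) <= query_size Q.
Proof.
  induction Q; simpl; rewrite ?fmls_size_app; try lia.
  unfold fmls_size; simpl; lia.
Qed.

Lemma length_subqueries Q : length (subqueries Q) <= query_size Q.
Proof.
  pose proof fml_size_pos. induction Q; simpl; rewrite ?length_app; auto; lia.
Qed.

Lemma subqueries_size P Q : In Q (subqueries P) -> query_size Q <= query_size P.
Proof.
  induction P; simpl; intros [<-|h]; simpl; rewrite ?in_app_iff in *;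
    intuition lia.
Qed.

Lemma query_atoms_subqueries P Q :
  In Q (subqueries P) -> incl (query_atoms Q) (query_atoms P).
Proof.
  induction P; simpl; intros [<-|h]; rewrite ?in_app_iff in *;
    intuition auto using incl_refl, incl_appl, incl_appr.
Qed.

Lemma strategy_queries_size T :
  queries_size (strategy_queries T) <= strategy_size T.
Proof.
  induction T as [|Q T0 IH0 T1 IH1]; simpl; [unfold queries_size; simpl; lia|].
  change (queries_size (Q :: ?l)) with (query_size Q + queries_size l).
  rewrite queries_size_app. lia.
Qed.

(** * Counting *)

Lemma length_flat_map_le {X Y} (f : X -> list Y) l c :
  (forall x, In x l -> length (f x) <= c) ->
  length (flat_map f l) <= length l * c.
Proof.
  induction l as [|x l IH]; intros h; simpl; [lia|].
  rewrite length_app. pose proof (h x (or_introl eq_refl)).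
  specialize (IH (fun y hy => h y (or_intror hy))). lia.
Qed.

Lemma length_remove_first A l : length (remove_first A l) <= length l.
Proof.
  induction l as [|B l IH]; simpl; [lia|].
  destruct (fml_eq_dec A B); simpl; lia.
Qed.

Lemma length_subfmls A : length (subfmls A) = fml_size A.
Proof. induction A; simpl; rewrite ?length_app; lia. Qed.

Lemma subfmls_size A B : In B (subfmls A) -> fml_size B <= fml_size A.
Proof.
  induction A; simpl; intros [<-|h]; simpl; rewrite ?in_app_iff in *;
    intuition lia.
Qed.

Lemma length_flat_map_subfmls l : length (flat_map subfmls l) = fmls_size l.
Proof.
  induction l as [|A l IH]; [reflexivity|].
  simpl. now rewrite length_app, length_subfmls, IH, fmls_size_cons.
Qed.

Definition base_fmls_bound (E : axiom_list) (L : list fml) : nat :=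
  fmls_size L + fmls_size E + 1.

Lemma fmls_size_base_fmls E L :
  fmls_size (L ++ rev E ++ [F0]) = base_fmls_bound E L.
Proof.
  unfold base_fmls_bound.
  rewrite !fmls_size_app, <- (fmls_size_permutation _ _ (Permutation_rev E)).
  now rewrite Nat.add_assoc.
Qed.

Lemma length_base_fmls E L : length (base_fmls E L) = base_fmls_bound E L.
Proof.
  unfold base_fmls. now rewrite length_flat_map_subfmls, fmls_size_base_fmls.
Qed.

Lemma base_fmls_size E L A :
  In A (base_fmls E L) -> fml_size A <= base_fmls_bound E L.
Proof.
  intros h. apply in_flat_map in h as (B & hB & h).
  rewrite <- fmls_size_base_fmls. apply subfmls_size in h.
  apply fml_size_le_fmls_size in hB. lia.
Qed.

Lemma length_tails l : length (tails l) = length l + 1.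
Proof. induction l; simpl; lia. Qed.

Lemma tails_length l st : In st (tails l) -> length st <= length l.
Proof.
  induction l as [|a l IH]; simpl; intros [<-|h]; simpl; try easy.
  specialize (IH h). lia.
Qed.

Lemma length_strategy_states T st :
  length (strategy_states st T) <= strategy_size T.
Proof.
  revert st. induction T as [|Q T0 IH0 T1 IH1]; intros st; simpl; [lia|].
  rewrite length_app.
  specialize (IH0 ((Q, false) :: st)). specialize (IH1 ((Q, true) :: st)). lia.
Qed.

Lemma strategy_states_length T st st' :
  In st' (strategy_states st T) -> length st' <= length st + strategy_size T.
Proof.
  revert st. induction T as [|Q T0 IH0 T1 IH1]; intros st; simpl;
    intros [<-|h]; try lia; try easy.
  apply in_app_or in h as [h|h]; [apply IH0 in h|apply IH1 in h];
    simpl in h; lia.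
Qed.

Ltac monotone :=
  repeat lazymatch goal with
    | |- _ + _ <= _ + _ => apply Nat.add_le_mono
    | |- _ * _ <= _ * _ => apply Nat.mul_le_mono
    end; auto; try lia.

Definition threshold_bound (n : nat) : nat :=
  (n + 1) * ((n + 2) + (n + 2) * (n + 1)).
Definition literal_bound (n : nat) : nat :=
  n * threshold_bound n + (threshold_bound n + (n + 1)).
Definition names_bound (n : nat) : nat :=
  (n + 2) * (n * (n * (1 + literal_bound n) + n * (1 + literal_bound n))) +
  literal_bound n.
Definition sides_bound (F : nat) : nat := 1 + (F + F * F).
Definition sequents_bound (n : nat) : nat :=
  let s := sides_bound ((n + 1) + names_bound n) in
  s * s + ((n + 2) * (n + 1) + ((n + 2) + 1)).

Lemma slices_le L n : length L <= n -> slices L <= n + 2.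
Proof. unfold slices. lia. Qed.

Section Counting.
Variables (base L : list fml) (n : nat).
Hypothesis L_length : length L <= n.
Hypothesis base_length : length base <= n + 1.

Lemma length_threshold_names l :
  length l <= n -> length (threshold_names base L l) <= threshold_bound n.
Proof.
  pose proof (slices_le _ _ L_length) as hm. intros hl. unfold threshold_bound.
  etransitivity; [|apply Nat.mul_le_mono_r, Nat.add_le_mono_r, hl]. clear hl.
  induction l as [|A l IH]; cbn [threshold_names];
    rewrite !length_app, length_map, length_seq; simpl; [lia|].
  assert (hc : length (threshold_conjunctions base L l) <= (n + 2) * (n + 1)).
  { etransitivity; [apply length_flat_map_le with (c := n + 1)|].
    - intros k _. now rewrite !length_map.
    - rewrite length_seq. monotone. }
  lia.
Qed.

Lemma length_literal_names : length (literal_names base L) <= literal_bound n.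
Proof.
  unfold literal_names, literal_bound. rewrite !length_app, length_map.
  pose proof (length_threshold_names L L_length).
  apply Nat.add_le_mono; [|lia].
  etransitivity; [apply length_flat_map_le with (c := threshold_bound n)|].
  - intros A _. apply length_threshold_names.
    pose proof (length_remove_first A L). lia.
  - monotone.
Qed.

Lemma length_value_names k Q b :
  length (value_names base L k Q b) <= query_size Q * (1 + literal_bound n).
Proof.
  pose proof length_literal_names.
  revert b. induction Q as [A|Q IH|Q IHQ R IHR|Q IHQ R IHR]; intros b; simpl.
  - pose proof (fml_size_pos A). nia.
  - specialize (IH (negb b)). lia.
  - specialize (IHQ b). specialize (IHR b). unfold or_names, and_names.
    destruct b; simpl; rewrite length_app, ?length_map; lia.
  - specialize (IHQ b). specialize (IHR b). unfold or_names, and_names.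
    destruct b; simpl; rewrite length_app, ?length_map; lia.
Qed.

Lemma length_query_names queries :
  length queries <= n -> (forall Q, In Q queries -> query_size Q <= n) ->
  length (query_names base L queries) <= names_bound n.
Proof.
  intros hl hs. pose proof (slices_le _ _ L_length) as hm.
  unfold query_names, names_bound. rewrite length_app.
  apply Nat.add_le_mono; [|exact length_literal_names].
  etransitivity; [apply length_flat_map_le|rewrite length_seq; monotone].
  intros k _.
  etransitivity; [apply length_flat_map_le|apply Nat.mul_le_mono_r, hl].
  intros Q hQ. rewrite length_app.
  apply Nat.add_le_mono; (etransitivity; [apply length_value_names|]);
    apply Nat.mul_le_mono_r, hs, hQ.
Qed.
End Counting.

Lemma length_short_sides F m :
  length F <= m -> length (short_sides F) <= sides_bound m.
Proof.
  intros h. unfold short_sides, sides_bound. cbn [length].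
  rewrite length_app, !length_map, length_prod.
  pose proof (Nat.mul_le_mono _ _ _ _ h h). lia.
Qed.

Lemma length_short_sequents F :
  length (short_sequents F) =
  length (short_sides F) * length (short_sides F).
Proof. apply length_prod. Qed.

Lemma short_sequents_size F z s :
  (forall A, In A F -> fml_size A <= z) -> In s (short_sequents F) ->
  sequent_size s <= 4 * z + 1.
Proof.
  intros hF hs. destruct s as [G D]. apply in_prod_iff in hs as [hG hD].
  assert (h : forall G, In G (short_sides F) -> fmls_size G <= 2 * z).
  { intros G' hG'. apply short_sides_inv in hG' as [hi hl].
    etransitivity; [apply fmls_size_le_length_mul; auto|].
    now apply Nat.mul_le_mono_r. }
  rewrite sequent_size_pair. apply h in hG, hD. lia.
Qed.

Lemma length_initial_state G D :
  length (initial_state G D) = length G + length D.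
Proof. unfold initial_state. now rewrite length_app, !length_map. Qed.

Lemma length_game_states G D T :
  length (game_states G D T) <= strategy_size T + length G + length D + 1.
Proof.
  unfold game_states. rewrite length_app, length_tails, length_initial_state.
  pose proof (length_strategy_states T (initial_state G D)). lia.
Qed.

Lemma game_states_length G D T st :
  In st (game_states G D T) ->
  length st <= strategy_size T + length G + length D.
Proof.
  intros h. apply in_app_or in h as [h|h];
    [apply strategy_states_length in h|apply tails_length in h];
    rewrite length_initial_state in h; lia.
Qed.

Lemma length_game_sequents name L G D T :
  length (game_sequents name L G D T) =
  slices L * length (game_states G D T) + (slices L + 1).
Proof.
  unfold game_sequents.
  now rewrite !length_app, !length_map, length_prod, length_seq.
Qed.

Lemma fmls_size_state_names name L k st :
  fmls_size (state_names name L k st) = length st.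
Proof.
  induction st as [|a st IH]; [reflexivity|].
  unfold state_names. simpl. now rewrite fmls_size_cons, <- IH.
Qed.

Lemma game_sequents_size L name G D T s :
  In s (game_sequents name L G D T) ->
  sequent_size s <=
    strategy_size T + length G + length D + fmls_size G + fmls_size D + 3.
Proof.
  intros h. apply in_app_or in h as [h|h];
    [|apply in_app_or in h as [h|[<-|[]]]].
  - apply in_map_iff in h as ([k st] & <- & h). apply in_prod_iff in h as [_ h].
    apply game_states_length in h. unfold slice_sequent.
    rewrite sequent_size_pair, !fmls_size_cons, fmls_size_app,
      fmls_size_state_names.
    simpl. lia.
  - apply in_map_iff in h as (k & <- & h).
    rewrite sequent_size_pair, fmls_size_cons. simpl. lia.
  - rewrite sequent_size_pair. lia.
Qed.

(** * Polynomial bounds *)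

Definition polynomially_bounded (f : nat -> nat) : Prop :=
  exists c d, forall n, 1 <= n -> f n <= c * n ^ d.

Lemma polynomially_bounded_const c : polynomially_bounded (fun _ => c).
Proof. exists c, 0. intros. simpl. lia. Qed.

Lemma polynomially_bounded_id : polynomially_bounded (fun n => n).
Proof. exists 1, 1. intros. simpl. lia. Qed.

Lemma polynomially_bounded_add f g :
  polynomially_bounded f -> polynomially_bounded g ->
  polynomially_bounded (fun n => f n + g n).
Proof.
  intros (c & d & hf) (c' & d' & hg). exists (c + c'), (d + d').
  intros n hn. specialize (hf n hn). specialize (hg n hn).
  pose proof (Nat.pow_le_mono_r n d (d + d') ltac:(lia) ltac:(lia)).
  pose proof (Nat.pow_le_mono_r n d' (d + d') ltac:(lia) ltac:(lia)).
  nia.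
Qed.

Lemma polynomially_bounded_mul f g :
  polynomially_bounded f -> polynomially_bounded g ->
  polynomially_bounded (fun n => f n * g n).
Proof.
  intros (c & d & hf) (c' & d' & hg). exists (c * c'), (d + d').
  intros n hn. specialize (hf n hn). specialize (hg n hn).
  rewrite Nat.pow_add_r.
  pose proof (Nat.mul_le_mono _ _ _ _ hf hg). lia.
Qed.

Lemma polynomially_bounded_cut_tree_cost m f :
  polynomially_bounded f ->
  polynomially_bounded (fun n => cut_tree_cost m (f n)).
Proof.
  intros hf. induction m as [|m IH]; cbn [cut_tree_cost];
    auto using polynomially_bounded_add, polynomially_bounded_mul,
      polynomially_bounded_const.
Qed.

Definition line_bound (n : nat) : nat :=
  12 * ((4 * (n + 3) + 1) + cut_depth * (n + 3)).
Definition proof_size_bound (n : nat) : nat :=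
  sequents_bound n * cut_tree_cost cut_depth (weakening_cost (line_bound n)) *
  line_bound n.

Lemma proof_size_bound_polynomial : polynomially_bounded proof_size_bound.
Proof.
  unfold proof_size_bound, line_bound, sequents_bound, sides_bound, names_bound,
    literal_bound, threshold_bound, weakening_cost. cbv zeta.
  repeat lazymatch goal with
  | |- polynomially_bounded (fun n => cut_tree_cost _ (@?f n)) =>
      apply (polynomially_bounded_cut_tree_cost _ f)
  | |- polynomially_bounded (fun n => @?f n + @?g n) =>
      apply (polynomially_bounded_add f g)
  | |- polynomially_bounded (fun n => @?f n * @?g n) =>
      apply (polynomially_bounded_mul f g)
  | |- polynomially_bounded (fun n => n) => apply polynomially_bounded_id
  | |- polynomially_bounded (fun _ => ?c) =>
      apply (polynomially_bounded_const c)
  end.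
Qed.

(** * The simulation *)

Section Simulation.
Variables (E : axiom_list) (Gamma Delta : list fml) (T : strategy).

Definition game_queries : list query :=
  map QF (Gamma ++ Delta) ++ strategy_queries T.

Definition game_atoms : list fml := flat_map query_atoms game_queries.

Definition all_queries : list query := flat_map subqueries game_queries.

Definition game_base : list fml := base_fmls E game_atoms.

Definition game_names : list cfml :=
  query_names game_base game_atoms all_queries.

Definition key_sequents (name : cfml -> nat) : list sequent :=
  short_sequents (key_fmls name game_base game_names) ++
  game_sequents name game_atoms Gamma Delta T.

Lemma all_queries_root Q : In Q game_queries -> In Q all_queries.
Proof. intros h. apply in_flat_map. eauto using subqueries_refl. Qed.

Lemma all_queries_closed Q :
  In Q all_queries -> incl (components Q) all_queries.
Proof.
  intros h R hR. apply in_flat_map in h as (P & hP & h).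
  apply in_flat_map. exists P. split; [exact hP|].
  now apply (subqueries_closed P Q h).
Qed.

Lemma all_queries_atoms Q : In Q all_queries -> incl (query_atoms Q) game_atoms.
Proof.
  intros h A hA. apply in_flat_map in h as (P & hP & h).
  apply in_flat_map. exists P. split; [exact hP|].
  now apply (query_atoms_subqueries P Q h).
Qed.

Lemma game_atoms_base : incl game_atoms game_base.
Proof. intros A hA. apply base_fmls_in, in_or_app. auto. Qed.

Lemma winning_cut_provable E' name z :
  ext_axioms E -> NB_proof E Gamma Delta T ->
  (forall X, In X game_names -> is_name E E' name X) ->
  (forall i, In (FExt i) game_base -> in_axioms E' i (nth i E F0)) ->
  (forall A, In A game_base -> fml_size A <= z) -> 3 <= z ->
  cut_provable E' z cut_depth (key_sequents name) (Gamma, Delta).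
Proof.
  intros hE hT hnames haxioms hsize hz proved hclosed.
  assert (hbase : grounded E (map CF game_base))
    by now apply grounded_base_fmls.
  pose proof game_atoms_base.
  assert (hlit : incl (literal_names game_base game_atoms) game_names)
    by apply query_names_literal.
  apply contexts_proved with (E := E) (E' := E') (name := name)
    (base := game_base) (names := game_names) (z := z) (L := game_atoms)
    (queries := all_queries) (T := T); auto.
  - apply grounded_query_names; auto. apply all_queries_atoms.
  - apply incl_tran with (2 := hlit), literal_names_base.
  - intros G D h. apply hclosed, in_or_app. auto.
  - exact all_queries_closed.
  - exact all_queries_atoms.
  - intros k Q b hk hQ. apply query_names_value; auto. apply all_queries_atoms.
  - intros A hA. apply all_queries_root, in_or_app. left. now apply in_map.
  - intros Q hQ. apply all_queries_root, in_or_app. auto.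
  - intros G D h. apply hclosed, in_or_app. auto.
Qed.

Notation n := (NB_size E Gamma Delta T).

Lemma NB_size_ge :
  fmls_size E + fmls_size Gamma + fmls_size Delta + length Gamma +
    length Delta + strategy_size T <= n.
Proof.
  assert (hE : forall l, fmls_size l <= axioms_size l).
  { unfold axioms_size. induction l as [|A l IH]; [easy|].
    rewrite fmls_size_cons. simpl in *. lia. }
  assert (hG : forall b l, fmls_size l + length l <=
    list_sum (map (fun a => query_size (fst a) + 2)
      (map (fun A => (QF A, b : bool)) l))).
  { induction l as [|A l IH]; [easy|].
    rewrite fmls_size_cons. simpl in *. lia. }
  unfold NB_size, state_size, initial_state. rewrite map_app, list_sum_app.
  specialize (hE E). pose proof (hG true Gamma). pose proof (hG false Delta).
  lia.
Qed.

Lemma queries_size_game : fmls_size E + queries_size game_queries <= n.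
Proof.
  unfold game_queries. pose proof NB_size_ge.
  pose proof (strategy_queries_size T).
  rewrite queries_size_app, queries_size_fmls, fmls_size_app. lia.
Qed.

Lemma length_all_queries : length all_queries <= n.
Proof.
  pose proof queries_size_game.
  apply Nat.le_trans with (queries_size game_queries); [|lia].
  unfold all_queries, queries_size. rewrite length_flat_map.
  clear. induction game_queries as [|Q l IH]; simpl; [easy|].
  pose proof (length_subqueries Q). lia.
Qed.

Lemma all_queries_size Q : In Q all_queries -> query_size Q <= n.
Proof.
  intros h. apply in_flat_map in h as (P & hP & h).
  pose proof queries_size_game. apply subqueries_size in h.
  apply query_size_le_queries_size in hP. lia.
Qed.

Lemma fmls_size_game_atoms : fmls_size game_atoms <= queries_size game_queries.
Proof.
  unfold game_atoms, queries_size.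
  induction game_queries as [|Q l IH]; simpl; [easy|].
  rewrite fmls_size_app. pose proof (fmls_size_query_atoms Q). lia.
Qed.

Lemma base_fmls_bound_game : base_fmls_bound E game_atoms <= n + 1.
Proof.
  unfold base_fmls_bound. pose proof queries_size_game.
  pose proof fmls_size_game_atoms. lia.
Qed.

Lemma game_base_size A : In A game_base -> fml_size A <= n + 3.
Proof.
  intros h. apply base_fmls_size in h. pose proof base_fmls_bound_game. lia.
Qed.

Lemma length_key_sequents name : length (key_sequents name) <= sequents_bound n.
Proof.
  pose proof NB_size_ge. pose proof queries_size_game.
  pose proof fmls_size_game_atoms. pose proof (length_le_fmls_size game_atoms).
  assert (hL : length game_atoms <= n) by lia.
  assert (hbase : length game_base <= n + 1)
    by (unfold game_base; rewrite length_base_fmls; exact base_fmls_bound_game).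
  assert (hkeys : length (key_fmls name game_base game_names) <=
    (n + 1) + names_bound n).
  { unfold key_fmls. rewrite length_app, length_map.
    apply Nat.add_le_mono; auto.
    apply length_query_names; auto using length_all_queries, all_queries_size. }
  unfold key_sequents, sequents_bound. cbv zeta.
  rewrite length_app, length_short_sequents, length_game_sequents.
  pose proof (length_short_sides _ _ hkeys) as hs.
  pose proof (slices_le _ _ hL). pose proof (length_game_states Gamma Delta T).
  monotone.
Qed.

Lemma key_sequents_size name s :
  In s (key_sequents name) -> sequent_size s <= 4 * (n + 3) + 1.
Proof.
  intros h. apply in_app_or in h as [h|h].
  - apply short_sequents_size with (2 := h). intros A hA.
    apply in_app_or in hA as [hA|hA]; [now apply game_base_size|].
    apply in_map_iff in hA as (X & <- & _). simpl. lia.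
  - apply game_sequents_size in h. pose proof NB_size_ge. lia.
Qed.

Lemma ext_index_bound (l : list fml) :
  exists m, forall i, In (FExt i) l -> i < m.
Proof.
  induction l as [|A l [m hm]]; [now exists 0|].
  exists (m + S match A with FExt i => i | _ => 0 end).
  intros i [->|h]; [lia|]. specialize (hm _ h). lia.
Qed.

Lemma eLNDT_simulation :
  ext_axioms E -> NB_proof E Gamma Delta T ->
  exists E' pi, ext_axioms E' /\ axioms_incl E E' /\
    eLNDT_proof E' pi (Gamma, Delta) /\ eLNDT_size pi <= proof_size_bound n.
Proof.
  intros hE hT.
  assert (hN : grounded E game_names).
  { apply grounded_query_names; auto using game_atoms_base, all_queries_atoms.
    now apply grounded_base_fmls. }
  destruct (ext_index_bound game_base) as [m hm].
  destruct (grounded_names E game_names m hE hN)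
    as (E' & name & hE' & hincl & hnames & haxioms).
  destruct (proof_of_cut_provable E' (n + 3) cut_depth (4 * (n + 3) + 1)
    (line_bound n) (key_sequents name) (Gamma, Delta)) as (pi & hpi & hsize).
  - apply key_sequents_size.
  - reflexivity.
  - apply winning_cut_provable; auto using game_base_size. lia.
  - exists E', pi. repeat split; auto; try apply hpi.
    etransitivity; [exact hsize|].
    apply Nat.mul_le_mono_r, Nat.mul_le_mono_r, length_key_sequents.
Qed.
End Simulation.

Theorem theorem6p1 :
  exists c d : nat,
  forall (E : axiom_list) (Gamma Delta : list fml) (T : strategy),
    ext_axioms E ->
    NB_proof E Gamma Delta T ->
    exists (E' : axiom_list) (pi : list sequent),
      ext_axioms E' /\ axioms_incl E E' /\
      eLNDT_proof E' pi (Gamma, Delta) /\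
      eLNDT_size pi <= c * NB_size E Gamma Delta T ^ d.
Proof.
  destruct proof_size_bound_polynomial as (c & d & hbound).
  exists c, d. intros E Gamma Delta T hE hT.
  destruct (eLNDT_simulation E Gamma Delta T hE hT)
    as (E' & pi & hE' & hincl & hpi & hsize).
  exists E', pi. repeat split; auto; try apply hpi.
  etransitivity; [exact hsize|]. apply hbound.
  unfold NB_size. destruct T; simpl; lia.
Qed.
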